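(* Let $d\ge 1$, let $p=p_d=\frac{2d+1}{4d}$, and let $(S_n)$ be the $d$-dimensional elephant random walk with memory parameter $p$ described in the context. Then $$\frac{1}{\sqrt{n\log n}}S_n\xrightarrow{\ \mathcal{L}\ }\mathcal{N}\Bigl(0,\frac1d I_d\Bigr),$$ where $\xrightarrow{\mathcal L}$ denotes convergence in distribution.
   Context: Multi-dimensional elephant random walk (MERW). Fix a dimension $d\ge1$ and a memory parameter $p\in[0,1]$. Let $(e_1,\dots,e_d)$ be the standard basis of $\mathbb{R}^d$, $I_d$ the $d\times d$ identity matrix, and $J_d$ the $d\times d$ cyclic permutation matrix with entries $(J_d)_{i,i+1}=1$ for $1\le i\le d-1$, $(J_d)_{d,1}=1$, and all other entries $0$. Set $S_0=0$. The first step $X_1$ is uniformly distributed on $\{\pm e_1,\dots,\pm e_d\}$. For $n\ge1$, given $\mathcal{F}_n=\sigma(X_1,\dots,X_n)$, $X_{n+1}=A_nX_{b_n}$, where $b_n$ is uniform on $\{1,\dots,n\}$ and $A_n$ is a random matrix, with $b_n$, $A_n$ independent of each other and of $\mathcal{F}_n$, equal to $I_d$ with probability $p$ and to each of $-I_d,\ \pm J_d,\dots,\pm J_d^{d-1}$ with probability $\frac{1-p}{2d-1}$. The position is $S_n=X_1+\dots+X_n$. *)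

(* Defs.v *)
From HB Require Import structures.
From mathcomp Require Import all_boot all_order all_algebra.
From mathcomp Require Import all_classical all_reals all_analysis.
Set Implicit Arguments. Unset Strict Implicit. Unset Printing Implicit Defensive.
Import Order.TTheory GRing.Theory Num.Theory.
Import numFieldNormedType.Exports.
Local Open Scope classical_set_scope.
Local Open Scope ring_scope.

Section MERW.
Variables (R : realType) (d : nat) (p : R).

Definition ebasis (i : 'I_d) : 'cV[R]_d := delta_mx i 0.

Definition Jmx : 'M[R]_d :=
  \matrix_(i < d, j < d) (((val j) == ((val i).+1 %% d)%N)%:R).

(** the step set {+-e_1, ..., +-e_d} (a duplicate-free list) *)
Definition steps : seq 'cV[R]_d :=
  flatten [seq [:: ebasis i; - ebasis i] | i <- enum 'I_d].

(** law of the random matrix A_n, as a list of (probability, matrix):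
    I_d w.p. p, each of -I_d, +-J_d, ..., +-J_d^(d-1) w.p. (1-p)/(2d-1) *)
Definition qw : R := (1 - p) / (2 * d%:R - 1).
Definition memory_law : seq (R * 'M[R]_d) :=
  (p, 1%:M) :: (qw, - 1%:M) ::
  flatten [seq [:: (qw, Jmx ^+ k); (qw, - Jmx ^+ k)] | k <- iota 1 (d.-1)].

(** conditional probability that the next step is y, given the history
    h = [:: X_1; ...; X_n] (n = size h); for h = [::] it is the law of X_1 *)
Definition step_prob (h : seq 'cV[R]_d) (y : 'cV[R]_d) : R :=
  if h is [::] then (y \in steps)%:R / (2 * d%:R)
  else (size h)%:R^-1 *
       \sum_(x <- h) \sum_(a <- memory_law) a.1 * (a.2 *m x == y)%:R.

Definition path_prob (s : seq 'cV[R]_d) : R :=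
  \prod_(k < size s) step_prob (take k s) (nth 0 s k).

(** all paths of length n with steps in [steps] (these carry all the mass) *)
Fixpoint paths (n : nat) : seq (seq 'cV[R]_d) :=
  if n is n'.+1 then [seq rcons s y | s <- paths n', y <- steps]
  else [:: [::]].

Definition merw_expect (g : 'cV[R]_d -> R) (n : nat) : R :=
  \sum_(s <- paths n) path_prob s * g (\sum_(x <- s) x).

(** E[ g(Z) ] for Z ~ N(0, s^2 I_d): iterated integral against the product
    of d copies of the library's one-dimensional normal law N(0, s^2). *)
Fixpoint gauss_iter (s : R) (k : nat) (g : 'cV[R]_d -> R) (v : 'cV[R]_d) : R :=
  if k is k'.+1 then
    fine (\int[normal_prob 0 s]_x
            (gauss_iter s k' g (\col_i (if val i == k' then x else v i 0)))%:E)%E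
  else g v.

Definition gauss_expect (s : R) (g : 'cV[R]_d -> R) : R :=
  gauss_iter s d g 0.

End MERW.

(** X_n converges in distribution (law) to N(0, s^2 I_d), where the laws of
    the X_n are given through their expectation functionals [E n g]:
    E[g(X_n)] -> E[g(Z)] for every bounded continuous g. *)
Definition conv_law_gauss (R : realType) (d : nat)
    (E : nat -> ('cV[R]_d -> R) -> R) (s : R) : Prop :=
  forall g : 'cV[R]_d -> R, continuous g -> (exists M : R, forall x, `|g x| <= M) ->
    (fun n => E n g) @ \oo --> gauss_expect s g.

(* Main.v *)
Require Import Defs.
From HB Require Import structures.
From mathcomp Require Import all_boot all_order all_algebra.
From mathcomp Require Import all_classical all_reals all_analysis.
From mathcomp Require Import measurable_realfun zify ring lra.
Set Implicit Arguments. Unset Strict Implicit. Unset Printing Implicit Defensive.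
Import Order.TTheory GRing.Theory Num.Theory.
Import numFieldNormedType.Exports.
Local Open Scope classical_set_scope.
Local Open Scope ring_scope.

(** Conditionally on its first n steps, the next step of the walk equals y with
    probability N_y / (2 n) + 1 / (4 d), where N_y counts the past steps equal to y.
    Hence every additive functional T_n = sum_(k <= n) f(X_k), with f summing to zero
    over the 2 d steps, satisfies E[T_(n+1) | F_n] = (1 + 1 / (2 n)) T_n, and its second
    moment is O(n log n).  Expanding E cos(w T_(n+1) + b) to second order relates it to
    exp(- w^2 Q / 2) E cos(w (1 + 1 / (2 n)) T_n + b), where Q is the mean of f^2 over
    the steps; iterating down to n = 1, the weights w_k^2 ~ 1 / (k log n) add up to 1 and
    a logarithmic Cesaro argument disposes of the errors.  With f(y) = <theta, y> this
    gives convergence of the characteristic functions of the rescaled walk.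

    To pass to a bounded continuous g, approximate it by a trigonometric polynomial H
    with |g - H| <= eps (1 + |x|^2) on the whole space; the second moments of both the
    rescaled walk and the Gaussian law are bounded.  The Gaussian characteristic function
    solves a linear differential equation by Stein's identity. *)

(** * Elementary inequalities and logarithmic means *)

(** At this [p] the excess weight of the identity is [p - qw = 1/2], the critical case: the
    martingale weights decay like [k^(-1/2)], so the martingale increments have variances of order
    [1/k], and summing these produces the extra logarithm. The obstacle in the second order
    expansion is that the conditional variance of the next step depends on the past through the
    empirical mean of [f^2]. But [f^2 - Q] again sums to zero over the steps, so the second moment
    estimate for [T] also controls this fluctuation, and no martingale limit theorem enters. The
    phase [b] keeps everything real: cosines with phases include sines and constants, and their span
    is stable under products and under Gaussian averaging. The error [eps (1 + |x|^2)] takes the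
    place of tightness and of a continuity theorem, since it can be averaged directly under both
    laws. On the Gaussian side it has a second use: [g] lies between two explicit functions whose
    iterated integrals are computable, so monotonicity alone locates the iterated integral of
    [g]. *)

Section real_bounds.
Variable R : realType.
Implicit Types x y A u : R.

(** Mean value inequality based at 0. Applied in turn to sine, cosine and their Taylor remainders,
    each bound serving as the derivative bound of the next; only the orders matter, not the
    constants. *)
Lemma norm_increment_le (f df : R -> R) (M x : R) :
  (forall y, is_derive y 1 f (df y)) ->
  (forall y, `|y| <= `|x| -> `|df y| <= M) -> `|f x - f 0| <= M * `|x|.
Proof.
move=> fdf dfM.
have cf a b : {within `[a, b], continuous f}.
  apply: continuous_subspaceT => y.
  by apply/differentiable_continuous/derivable1_diffP.
have [x0|x0|<-] := ltgtP 0 x.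
- have [c cx ->] := MVT x0 (fun y _ => fdf y) (cf 0 x).
  rewrite subr0 normrM ler_wpM2r// dfM//.
  by move: cx; rewrite in_itv /= => /andP[c0 cx]; rewrite !gtr0_norm// ltW.
- have [c cx] := MVT x0 (fun y _ => fdf y) (cf x 0).
  rewrite -normrN opprB sub0r => ->; rewrite normrM normrN ler_wpM2r// dfM//.
  by move: cx; rewrite in_itv /= => /andP[c0 cx]; rewrite !ltr0_norm// lerN2 ltW.
- by rewrite subrr normr0 mulr0.
Qed.

Lemma norm_sin_le x : `|sin x| <= `|x|.
Proof.
have := @norm_increment_le sin cos 1 x (@is_derive_sin R) (fun y _ => cos_max y).
by rewrite sin0 subr0 mul1r.
Qed.

Lemma norm_cosB1_le x : `|cos x - 1| <= x ^+ 2.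
Proof.
have H y : `|y| <= `|x| -> `|- sin y| <= `|x|.
  by rewrite normrN; exact: le_trans (norm_sin_le y).
have := @norm_increment_le cos (fun y => - sin y) `|x| x (@is_derive_cos R) H.
by rewrite cos0 -expr2 real_normK// num_real.
Qed.

Lemma norm_sinB_le x : `|sin x - x| <= `|x| ^+ 3.
Proof.
have H y : `|y| <= `|x| -> `|cos y - 1| <= `|x| ^+ 2.
  move=> yx; apply: (le_trans (norm_cosB1_le y)).
  by rewrite -(real_normK (num_real y)) lerXn2r ?nnegrE.
have D (y : R) : is_derive y 1 (fun y : R => sin y - y) (cos y - 1).
  exact: is_deriveB.
have := norm_increment_le D H.
by rewrite sin0 subrr subr0 -exprSr.
Qed.

Lemma norm_cosB2_le x : `|cos x - (1 - x ^+ 2 / 2)| <= x ^+ 4.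
Proof.
have H y : `|y| <= `|x| -> `|- sin y + y| <= `|x| ^+ 3.
  move=> yx; rewrite -normrN opprD opprK; apply: (le_trans (norm_sinB_le y)).
  by rewrite lerXn2r ?nnegrE.
have D (y : R) : is_derive y 1 (fun y : R => cos y - (1 - 2^-1 * y ^+ 2)) (- sin y + y).
  by apply: is_derive_eq; rewrite /GRing.scale /=; field.
have := norm_increment_le D H.
have -> : `|x| ^+ 3 * `|x| = x ^+ 4.
  by rewrite -exprSr -normrX ger0_norm// exprn_even_ge0.
by rewrite cos0 expr0n /= mulr0 subr0 subrr subr0 [x ^+ 2 / 2]mulrC.
Qed.

Lemma cos_taylor A y :
  `|cos (A + y) - (cos A - y * sin A - y ^+ 2 / 2 * cos A)| <= `|y| ^+ 3 + y ^+ 4.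
Proof.
have -> : cos (A + y) - (cos A - y * sin A - y ^+ 2 / 2 * cos A) =
  - (sin A * (sin y - y)) + cos A * (cos y - (1 - y ^+ 2 / 2)).
  by rewrite cosD; ring.
rewrite (le_trans (ler_normD _ _))// normrN !normrM lerD//.
  by rewrite (le_trans _ (norm_sinB_le y))// ler_piMl// sin_max.
by rewrite (le_trans _ (norm_cosB2_le y))// ler_piMl// cos_max.
Qed.

Lemma norm_cosDB_le A y : `|cos (A + y) - cos A| <= `|y|.
Proof.
have D (z : R) : is_derive z 1 (fun z : R => cos (A + z)) (- sin (A + z)).
  have d1 : is_derive z 1 (fun z : R => A + z) 1.
    by apply: is_derive_eq; rewrite /GRing.scale /=; ring.
  have := @is_derive1_comp _ cos (fun z : R => A + z) z _ _ (is_derive_cos (A + z)) d1.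
  by rewrite mulr1.
have H z : `|z| <= `|y| -> `|- sin (A + z)| <= 1 by rewrite normrN sin_max.
by have := norm_increment_le D H; rewrite addr0 mul1r.
Qed.

Lemma expRN_bound u : 0 <= u -> `|1 - u - expR (- u)| <= u ^+ 2.
Proof.
move=> u0; have h1 := expR_ge1Dx (- u).
have h2 : expR (- u) <= 1 - u + u ^+ 2.
  rewrite expRN; have e1 := expR_ge1Dx u.
  have u1 : 0 < 1 + u by lra.
  apply: (@le_trans _ _ (1 + u)^-1); first by rewrite lef_pV2 ?posrE ?expR_gt0.
  (* Multiplied by [1 + u], the claim reads [1 <= 1 + u ^+ 3]. *)
  rewrite -(ler_pM2l u1) divff ?gt_eqF//.
  by have := exprn_ge0 3 u0; nra.
rewrite ler_norml; apply/andP; split; first lra.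
by have := sqr_ge0 u; lra.
Qed.

Lemma ln_le_harm n : ln n.+1%:R <= \sum_(i < n) i.+1%:R^-1 :> R.
Proof.
elim: n => [|n IH]; first by rewrite big_ord0 ln1.
rewrite big_ord_recr /=.
have -> : ln n.+2%:R = ln n.+1%:R + ln (1 + n.+1%:R^-1) :> R.
  rewrite -lnM ?posrE ?addr_gt0 ?invr_gt0//; congr ln.
  by rewrite -[in LHS]natr1; field.
rewrite lerD// le_ln1Dx// (lt_le_trans (ltrN10 _))// invr_ge0.
Qed.

Lemma harm_le_ln n : \sum_(i < n.+1) i.+1%:R^-1 <= 1 + ln n.+1%:R :> R.
Proof.
elim: n => [|n IH]; first by rewrite big_ord_recr big_ord0 /= ln1 invr1 add0r addr0.
rewrite big_ord_recr /= (le_trans (lerD IH (lexx _)))// -addrA lerD2l.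
have -> : ln n.+1%:R = ln n.+2%:R + ln (1 - n.+2%:R^-1) :> R.
  rewrite -lnM ?posrE//; last by rewrite subr_gt0 invf_lt1// ltr1n.
  by congr ln; rewrite -[in LHS](addrK 1 n.+1%:R) natr1; field.
rewrite -addrA gerDl -lerBrDr sub0r.
by rewrite (le_trans (le_ln1Dx _))// ltrN2 invf_lt1// ltr1n.
Qed.

Lemma near_ln_ge (M : R) : \forall n \near \oo, M <= ln n%:R :> R.
Proof.
near=> n; rewrite -[M]expRK ler_ln ?posrE ?expR_gt0//.
  by near: n; exact: nbhs_infty_ger.
by rewrite ltr0n; near: n; exact: nbhs_infty_gt.
Unshelve. all: by end_near. Qed.

Lemma cvgn_inv_ln : (ln n%:R)^-1 @[n --> \oo] --> (0 : R).
Proof.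
apply/cvgrPdist_le => e e0; near=> n.
have : e^-1 <= ln n%:R by near: n; exact: near_ln_ge.
move=> h; have l0 : 0 < ln n%:R :> R by rewrite (lt_le_trans _ h)// invr_gt0.
by rewrite sub0r normrN ger0_norm ?invr_ge0 ?(ltW l0)// -[e]invrK lef_pV2// posrE invr_gt0.
Unshelve. all: by end_near. Qed.

Lemma log_cesaro0 (x : R^nat) : x @ \oo --> (0 : R) ->
  (\sum_(k < n) x k / k.+1%:R) / ln n%:R @[n --> \oo] --> (0 : R).
Proof.
move=> x0; apply/cvgrPdist_le => e e0.
(* Once [1 <= ln n], a tail of at most [e/4 * (1 + ln n)] stays below [e/2 * ln n]; the other half
   is left for the fixed head [C]. *)
have e2 : 0 < e / 2 / 2 by rewrite !divr_gt0.
have /cvgrPdist_le/(_ _ e2)[N _ xN] := x0.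
pose C := \sum_(k < N) `|x k / k.+1%:R|.
near=> n.
have nN : (N <= n)%N by near: n; exact: nbhs_infty_ge.
have n0 : (0 < n)%N by near: n; exact: nbhs_infty_gt.
have l1 : 1 <= ln n%:R :> R by near: n; exact: near_ln_ge.
have lC : C / (e / 2) <= ln n%:R by near: n; exact: near_ln_ge.
have l0 : 0 < ln n%:R :> R by rewrite (lt_le_trans _ l1).
rewrite sub0r normrN normrM [X in _ * X]ger0_norm ?invr_ge0 ?(ltW l0)//.
rewrite ler_pdivrMr//.
apply: (@le_trans _ _ (C + e / 2 / 2 * (1 + ln n%:R))).
  rewrite -(big_mkord xpredT (fun k => x k / k.+1%:R)) (big_cat_nat (n := N))//=.
  rewrite (le_trans (ler_normD _ _))// lerD//.
    by rewrite big_mkord (le_trans (ler_norm_sum _ _ _)).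
  rewrite (le_trans (ler_norm_sum _ _ _))//.
  have h := harm_le_ln n.-1; rewrite prednK// in h.
  apply: le_trans (ler_wpM2l (ltW e2) h).
  rewrite -(big_mkord xpredT (fun k => k.+1%:R^-1)) [leRHS]mulrC mulr_suml.
  rewrite [leRHS](big_cat_nat (n := N))//= ler_wpDl//.
    by apply: sumr_ge0 => i _; rewrite mulr_ge0 ?invr_ge0// ltW.
  rewrite big_nat_cond [leRHS]big_nat_cond; apply: ler_sum => k /andP[/andP[Nk _] _].
  rewrite normrM normfV (ger0_norm (ler0n _ _)) mulrC ler_wpM2l ?invr_ge0//.
  by have := xN k Nk; rewrite sub0r normrN.
have : C <= e / 2 * ln n%:R by rewrite mulrC -ler_pdivrMr// divr_gt0.
have : 0 <= e / 2 / 2 * (ln n%:R - 1) by rewrite mulr_ge0 ?subr_ge0 ?(ltW e2).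
lra.
Unshelve. all: by end_near. Qed.

Lemma cvgn_harm_ln :
  (\sum_(k < n) k.+1%:R^-1) / ln n%:R @[n --> \oo] --> (1 : R).
Proof.
pose h0 (n : nat) : R := (\sum_(k < n) k.+1%:R^-1) / ln n%:R.
have H : \forall n \near \oo, 1 <= h0 n <= 1 + (ln n%:R)^-1.
  near=> n.
  have n0 : (0 < n)%N by near: n; exact: nbhs_infty_gt.
  have l1 : 1 <= ln n%:R :> R by near: n; exact: near_ln_ge.
  have l0 : 0 < ln n%:R :> R by rewrite (lt_le_trans _ l1).
  have h := harm_le_ln n.-1; rewrite prednK// in h.
  have h2 := ln_le_harm n.
  rewrite /h0 ler_pdivlMr// ler_pdivrMr// mul1r mulrDl mul1r mulVf ?gt_eqF// [_ + 1]addrC h andbT.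
  by rewrite (le_trans _ h2)// ler_ln ?posrE ?ltr0n// ler_nat.
apply: (squeeze_cvgr H); first exact: cvg_cst.
rewrite -[X in _ --> X]addr0; apply: cvgD; first exact: cvg_cst.
exact: cvgn_inv_ln.
Unshelve. all: by end_near. Qed.

Lemma log_cesaro (x : R^nat) (l : R) : x @ \oo --> l ->
  (\sum_(k < n) x k / k.+1%:R) / ln n%:R @[n --> \oo] --> l.
Proof.
move=> xl.
have x0 : (fun n => x n - l) @ \oo --> (0 : R) by apply/subr_cvg0.
have := cvgD (log_cesaro0 x0) (cvgM (cvg_cst l) cvgn_harm_ln).
rewrite add0r mulr1 => H; apply: (cvg_trans _ (H _ _ _)); apply: near_eq_cvg; apply: nearW => n /=.
rewrite !fctE /= mulrA -mulrDl mulr_sumr -big_split /=; congr (_ / _).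
by apply: eq_bigr => i _; ring.
Qed.

Lemma cvgn_harm_mean : (\sum_(i < n) i.+1%:R^-1) / n%:R @[n --> \oo] --> (0 : R).
Proof.
have := cesaro (@cvg_harmonic R).
move=> H; rewrite -cvg_shiftS /=; apply: (cvg_trans _ H); apply: near_eq_cvg; apply: nearW => n /=.
by rewrite /arithmetic_mean /= /series /= big_mkord mulrC.
Qed.

End real_bounds.

(** * The walk and its additive functionals *)
Section walk.
Variables (R : realType) (d : nat).
Hypothesis d0 : (0 < d)%N.
Let p : R := (2 * d%:R + 1) / (4 * d%:R).
Notation V := 'cV[R]_d.
Notation st := (steps R d).

Lemma dR_neq0 : d%:R != 0 :> R. Proof. by rewrite pnatr_eq0 -lt0n. Qed.

Lemma sum_steps (W : zmodType) (F : V -> W) :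
  \sum_(y <- st) F y = \sum_(i < d) (F (ebasis R i) + F (- ebasis R i)).
Proof.
rewrite /steps big_flatten big_map big_enum /=; apply: eq_bigr => i _.
by rewrite !big_cons big_nil addr0.
Qed.

Lemma stepsP (y : V) :
  reflect (exists i, y = ebasis R i \/ y = - ebasis R i) (y \in st).
Proof.
apply: (iffP flattenP) => [[l /mapP[i _ ->]]|[i yi]].
  by rewrite !inE => /orP[]/eqP ->; exists i; [left|right].
exists [:: ebasis R i; - ebasis R i]; first by apply/mapP; exists i; rewrite ?mem_enum.
by rewrite !inE; case: yi => ->; rewrite eqxx ?orbT.
Qed.

Lemma ebasisE (i j : 'I_d) : ebasis R i j 0 = (j == i)%:R.
Proof. by rewrite mxE eqxx andbT. Qed.

Lemma ebasis_eq (i j : 'I_d) : (ebasis R i == ebasis R j) = (i == j).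
Proof.
apply/eqP/eqP => [/matrixP/(_ i 0)|->//]; rewrite !ebasisE eqxx.
by case: eqP => // _ /eqP; rewrite oner_eq0.
Qed.

Lemma ebasis_eqN (i j : 'I_d) : (ebasis R i == - ebasis R j) = false.
Proof.
apply/eqP => /matrixP/(_ i 0); rewrite [RHS]mxE !ebasisE eqxx.
by case: (i == j) => /eqP; rewrite ?mulr0n ?oppr0 ?oner_eq0// -subr_eq0 opprK (_ : 1 + true%:R = 2%:R)// pnatr_eq0.
Qed.

Lemma sum_steps_pick (F : V -> R) (z : V) : z \in st ->
  \sum_(y <- st) (z == y)%:R * F y = F z.
Proof.
case/stepsP => j zj; rewrite sum_steps.
rewrite (bigD1 j)//= big1 ?addr0 => [|i ij].
  case: zj => ->; rewrite ?eqr_opp ?ebasis_eq ?eqxx ?ebasis_eqN.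
    by rewrite mul1r mul0r addr0.
  by rewrite eq_sym ebasis_eqN mul1r mul0r add0r.
case: zj => ->; rewrite ?eqr_opp ?ebasis_eq ?ebasis_eqN.
  by rewrite eq_sym (negbTE ij) !mul0r addr0.
by rewrite eq_sym ebasis_eqN eq_sym (negbTE ij) !mul0r addr0.
Qed.

Lemma Jmx_ebasis (j : 'I_d) : Jmx R d *m ebasis R j = ebasis R (ord_pred j).
Proof.
rewrite -colE; apply/matrixP => i k; rewrite ord1 ebasisE !mxE; congr (_%:R).
rewrite -(inj_eq (@ordS_inj d)) ord_predK eq_sym.
by rewrite -(inj_eq val_inj).
Qed.

Lemma JmxX_ebasis k (j : 'I_d) :
  Jmx R d ^+ k *m ebasis R j = ebasis R (iter k (@ord_pred d) j).
Proof.
elim: k => [|k IH]; first by rewrite expr0 mul1mx.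
by rewrite exprS -mulmxE -mulmxA IH Jmx_ebasis.
Qed.

Lemma val_iter_ord_pred k (j : 'I_d) : (k <= d)%N ->
  val (iter k (@ord_pred d) j) = ((j + (d - k)) %% d)%N.
Proof.
elim: k => [_|k IH kd]; first by rewrite subn0 modnDr modn_small.
rewrite iterS /= IH ?(ltnW kd)//.
have -> a : (a + d).-1 = (a + d.-1)%N by lia.
rewrite modnDml (_ : j + (d - k) + d.-1 = j + (d - k.+1) + d)%N ?modnDr//.
by lia.
Qed.

Lemma sum_iter_ord_pred (W : zmodType) (G : 'I_d -> W) (j : 'I_d) :
  \sum_(0 <= k < d) G (iter k (@ord_pred d) j) = \sum_(i < d) G i.
Proof.
rewrite big_mkord [RHS](reindex_inj (h := fun k : 'I_d => iter k (@ord_pred d) j))//.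
move=> k1 k2 /(congr1 val); rewrite !val_iter_ord_pred ?(ltnW (ltn_ord _))//.
(* Injectivity of [k |-> j - k] modulo [d]: adding [k1 + k2] on both sides removes the truncated
   subtractions. *)
move/eqP; rewrite eqn_modDl -(eqn_modDr (k1 + k2)).
have k1d := ltn_ord k1; have k2d := ltn_ord k2.
have -> : (d - k1 + (k1 + k2) = k2 + d)%N by lia.
have -> : (d - k2 + (k1 + k2) = k1 + d)%N by lia.
by rewrite !modnDr !modn_small// => /eqP k12; apply/val_inj.
Qed.

(** Splitting the weight of the identity as [(p - qw) + qw] leaves the same weight [qw] on all [2 d]
    matrices, whose values at [x] exhaust the step set. *)
Lemma sum_memory_law (F : V -> R) (x : V) : x \in st ->
  \sum_(a <- memory_law d p) a.1 * F (a.2 *m x) =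
  (p - qw d p) * F x + qw d p * \sum_(y <- st) F y.
Proof.
move=> xst.
have H : \sum_(0 <= k < d) (F (Jmx R d ^+ k *m x) + F (- (Jmx R d ^+ k *m x))) =
         \sum_(y <- st) F y.
  rewrite sum_steps; case/stepsP: xst => j [->|->].
    rewrite -[RHS](sum_iter_ord_pred _ j).
    by apply: eq_bigr => k _; rewrite JmxX_ebasis.
  rewrite -[RHS](sum_iter_ord_pred _ j).
  by apply: eq_bigr => k _; rewrite mulmxN opprK JmxX_ebasis addrC.
rewrite -H big_ltn// expr0 mul1mx /memory_law !big_cons /= mul1mx mulNmx mul1mx.
rewrite big_flatten big_map /=.
under eq_bigr do rewrite !big_cons big_nil /= addr0 -mulrDr mulNmx.
rewrite -mulr_sumr -subn1 -/(index_iota 1 d).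
by ring.
Qed.

Lemma memory_mem (x : V) a : x \in st -> a \in memory_law d p -> a.2 *m x \in st.
Proof.
move=> xst.
have N y : y \in st -> - y \in st.
  case/stepsP => i yi; apply/stepsP; exists i.
  by case: yi => ->; rewrite ?opprK; [right|left].
have J k : Jmx R d ^+ k *m x \in st.
  case/stepsP: xst => j xj; apply/stepsP; exists (iter k (@ord_pred d) j).
  by case: xj => ->; rewrite ?mulmxN JmxX_ebasis; [left|right].
rewrite !inE => /orP[/eqP->|/orP[/eqP ->|]] /=; rewrite ?mulNmx ?mul1mx ?N//.
case/flattenP => l /mapP[k _ ->]; rewrite !inE => /orP[]/eqP -> //=.
by rewrite mulNmx N.
Qed.

Lemma qwE : qw d p = (4 * d%:R)^-1.
Proof.
have dn := dR_neq0; have d1 : 1 <= d%:R :> R by rewrite ler1n.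
rewrite /qw /p; field; rewrite dn /=.
by apply/negP => /eqP; lra.
Qed.

Lemma pBqw : p - qw d p = 2^-1.
Proof. by rewrite qwE /p; field; exact: dR_neq0. Qed.

(* The images of a step under [+-J^k] run once through all steps, so the next step
   repeats a uniformly chosen past one with probability [p - qw = 1/2] and is
   otherwise uniform. *)
Lemma sum_step_prob (s : seq V) (F : V -> R) : s != [::] -> {subset s <= st} ->
  \sum_(y <- st) step_prob p s y * F y =
  (\sum_(x <- s) F x) / (2 * (size s)%:R) + (\sum_(y <- st) F y) / (4 * d%:R).
Proof.
move=> s0 sst.
transitivity ((size s)%:R^-1 * \sum_(x <- s) (2^-1 * F x + (4 * d%:R)^-1 * \sum_(y <- st) F y)).
  transitivity (\sum_(y <- st) ((size s)%:R^-1 *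
       \sum_(x <- s) \sum_(a <- memory_law d p) a.1 * (a.2 *m x == y)%:R) * F y).
    by case: s s0 {sst}.
  under eq_bigr do rewrite -mulrA mulr_suml.
  rewrite -mulr_sumr exchange_big /=; congr (_ * _).
  rewrite big_seq [RHS]big_seq; apply: eq_bigr => x xs.
  under eq_bigr do rewrite mulr_suml.
  rewrite exchange_big /= -pBqw -qwE -sum_memory_law ?sst//.
  rewrite big_seq [RHS]big_seq; apply: eq_bigr => a al.
  under eq_bigr do rewrite -mulrA.
  by rewrite -mulr_sumr sum_steps_pick// memory_mem// sst.
have sn : (size s)%:R != 0 :> R by rewrite pnatr_eq0 size_eq0.
rewrite big_split /= -mulr_sumr big_const_seq count_predT iter_addr_0 -mulr_natr.
by field; rewrite sn dR_neq0.
Qed.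

Lemma sum_step_prob_nil (F : V -> R) :
  \sum_(y <- st) step_prob p [::] y * F y = (\sum_(y <- st) F y) / (2 * d%:R).
Proof.
rewrite mulr_suml big_seq [RHS]big_seq; apply: eq_bigr => y yst.
by rewrite /step_prob yst mul1r mulrC.
Qed.

Lemma sum_step_prob1 (s : seq V) : {subset s <= st} ->
  \sum_(y <- st) step_prob p s y = 1.
Proof.
have c : \sum_(y <- st) (1 : R) = 2 * d%:R.
  rewrite sum_steps sumr_const card_ord -mulr_natr; by ring.
move=> sst; under eq_bigr do rewrite -[step_prob _ _ _]mulr1.
have dn := dR_neq0.
case: (eqVneq s [::]) => [->|s0]; first by rewrite sum_step_prob_nil c divff// mulf_neq0.
have sn : (size s)%:R != 0 :> R by rewrite pnatr_eq0 size_eq0.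
rewrite sum_step_prob// c big_const_seq count_predT iter_addr_0.
by field; rewrite dn sn.
Qed.

Lemma qw_ge0 : 0 <= qw d p.
Proof. by rewrite qwE invr_ge0 mulr_ge0. Qed.

Lemma step_prob_ge0 (s : seq V) y : 0 <= step_prob p s y.
Proof.
case: s => [|x s]; first by rewrite mulr_ge0// invr_ge0 mulr_ge0.
rewrite /step_prob mulr_ge0// ?invr_ge0//; apply: sumr_ge0 => z _.
rewrite big_seq; apply: sumr_ge0 => a ia; rewrite mulr_ge0//.
have q0 := qw_ge0.
have p0 : 0 <= p by rewrite -[p](subrK (qw d p)) pBqw addr_ge0// invr_ge0.
move: ia; rewrite !inE => /orP[/eqP->//|/orP[/eqP ->//|]].
by case/flattenP => l /mapP[k _ ->]; rewrite !inE => /orP[]/eqP ->.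
Qed.

Lemma path_prob_ge0 (s : seq V) : 0 <= path_prob p s.
Proof. by apply: prodr_ge0 => k _; exact: step_prob_ge0. Qed.

Lemma path_prob_rcons (s : seq V) y :
  path_prob p (rcons s y) = path_prob p s * step_prob p s y.
Proof.
rewrite /path_prob size_rcons big_ord_recr /= nth_rcons ltnn eqxx.
rewrite -cats1 take_size_cat//; congr (_ * _).
apply: eq_bigr => k _; rewrite nth_cat ltn_ord takel_cat//.
exact: ltnW.
Qed.

Lemma pathsP n s : s \in paths R d n -> size s = n /\ {subset s <= st}.
Proof.
elim: n s => [|n IH] s /=; first by rewrite inE => /eqP ->.
case/allpairsP => -[s' y] /= [/IH[sz sub] yst ->].
rewrite size_rcons sz; split=> // x; rewrite mem_rcons inE.
by case/orP => [/eqP ->|/sub].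
Qed.

(** Integrates functionals of the whole path, whereas [merw_expect] sees only its endpoint: the law
    of the next step is not a function of the position. *)
Definition wexp n (F : seq V -> R) : R := \sum_(s <- paths R d n) path_prob p s * F s.

Lemma wexp0 F : wexp 0 F = F [::].
Proof. by rewrite /wexp /= big_seq1 /path_prob big_ord0 mul1r. Qed.

(** The tower property, conditioning on the first [n] steps. *)
Lemma wexpS n F :
  wexp n.+1 F = wexp n (fun s => \sum_(y <- st) step_prob p s y * F (rcons s y)).
Proof.
rewrite /wexp /= big_allpairs_dep /=; apply: eq_bigr => s _.
by rewrite mulr_sumr; apply: eq_bigr => y _; rewrite path_prob_rcons mulrA.
Qed.

Lemma eq_wexp n F G : (forall s, size s = n -> {subset s <= st} -> F s = G s) ->
  wexp n F = wexp n G.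
Proof.
move=> FG; rewrite /wexp big_seq [RHS]big_seq; apply: eq_bigr => s /pathsP[? ?].
by rewrite FG.
Qed.

Lemma le_wexp n F G : (forall s, size s = n -> {subset s <= st} -> F s <= G s) ->
  wexp n F <= wexp n G.
Proof.
move=> FG; rewrite /wexp big_seq [leRHS]big_seq; apply: ler_sum => s /pathsP[? ?].
by rewrite ler_wpM2l ?path_prob_ge0// FG.
Qed.

Lemma wexpD n F G : wexp n (fun s => F s + G s) = wexp n F + wexp n G.
Proof. by rewrite /wexp -big_split; apply: eq_bigr => s _; rewrite mulrDr. Qed.

Lemma wexpZ n c F : wexp n (fun s => c * F s) = c * wexp n F.
Proof. by rewrite /wexp mulr_sumr; apply: eq_bigr => s _; rewrite mulrCA. Qed.

Lemma wexpB n F G : wexp n (fun s => F s - G s) = wexp n F - wexp n G.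
Proof.
rewrite -[in RHS]mulN1r -wexpZ -wexpD; congr (wexp _ _).
by apply/funext => s; rewrite mulN1r.
Qed.

Lemma wexp_cst n c : wexp n (fun=> c) = c.
Proof.
have -> : (fun=> c) = (fun s : seq V => c * 1) by apply/funext => s; rewrite mulr1.
rewrite wexpZ (_ : wexp n _ = 1) ?mulr1//.
elim: n => [|n IH]; first by rewrite wexp0.
rewrite wexpS -[RHS]IH; apply: eq_wexp => s _ sst.
by under eq_bigr do rewrite mulr1; rewrite sum_step_prob1.
Qed.

Lemma wexp_sum n (I : Type) (r : seq I) (F : I -> seq V -> R) :
  wexp n (fun s => \sum_(i <- r) F i s) = \sum_(i <- r) wexp n (F i).
Proof.
rewrite /wexp exchange_big /=; apply: eq_bigr => s _.
by rewrite mulr_sumr.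
Qed.

Lemma ler_norm_wexp n F : `|wexp n F| <= wexp n (fun s => `|F s|).
Proof.
rewrite (le_trans (ler_norm_sum _ _ _))//; apply: ler_sum => s _.
by rewrite normrM ger0_norm ?path_prob_ge0.
Qed.

Definition harm n : R := \sum_(i < n) i.+1%:R^-1.

Lemma harm_ge0 n : 0 <= harm n.
Proof. by apply: sumr_ge0 => i _; rewrite invr_ge0. Qed.

(** The conditional mean [T / (2 n)] of the next term turns the cross term into [T^2 / n], so the
    second moments satisfy [u (n+1) <= (1 + 1/n) u n + K^2]; the sequence [K^2 n (harm n)] solves
    this recursion with equality. *)
Lemma wexp_sum_sqr n (f : V -> R) K : \sum_(y <- st) f y = 0 ->
  {in st, forall y, `|f y| <= K} ->
  wexp n (fun s => (\sum_(x <- s) f x) ^+ 2) <= K ^+ 2 * (n%:R * harm n).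
Proof.
move=> f0 fK.
have fK2 y : y \in st -> f y ^+ 2 <= K ^+ 2.
  move=> yst; rewrite -real_normK ?num_real//; apply: lerXn2r; rewrite ?nnegrE ?fK//.
  exact: le_trans (normr_ge0 _) (fK _ yst).
have PK s : {subset s <= st} -> \sum_(y <- st) step_prob p s y * f y ^+ 2 <= K ^+ 2.
  move=> sst; rewrite -[leRHS]mul1r -(sum_step_prob1 sst) mulr_suml.
  rewrite big_seq [leRHS]big_seq; apply: ler_sum => y yst.
  by rewrite ler_wpM2l ?step_prob_ge0// fK2.
elim: n => [|n IH]; first by rewrite wexp0 big_nil expr0n mul0r mulr0.
rewrite wexpS.
(* The first step has no past to draw from, and [1/n] is meaningless there. *)
have [->|n0] := eqVneq n 0%N.
  rewrite wexp0 /harm big_ord_recl big_ord0 addr0 invr1 !mulr1.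
  under eq_bigr do rewrite big_cons big_nil addr0.
  exact: PK.
have nn : n%:R != 0 :> R by rewrite pnatr_eq0.
apply: (@le_trans _ _ (wexp n (fun s => (1 + n%:R^-1) * (\sum_(x <- s) f x) ^+ 2 + K ^+ 2))).
  apply: le_wexp => s sz sst.
  set T := \sum_(x <- s) f x.
  under eq_bigr do rewrite big_rcons/= -/T sqrrD mulrDr mulrDr.
  rewrite !big_split /= -mulr_suml sum_step_prob1// mul1r.
  apply: lerD; last exact: PK.
  have -> : \sum_(i <- st) step_prob p s i * (T * f i *+ 2) =
            2 * T * \sum_(i <- st) step_prob p s i * f i.
    by rewrite mulr_sumr; apply: eq_bigr => i _; rewrite -mulr_natr; ring.
  rewrite sum_step_prob// ?f0; last by rewrite -size_eq0 sz.
  rewrite -/T sz le_eqVlt; apply/orP; left; apply/eqP; field.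
  by rewrite nn dR_neq0.
rewrite wexpD wexpZ wexp_cst /harm big_ord_recr /= -/(harm n).
have -> : K ^+ 2 * (n.+1%:R * (harm n + n.+1%:R^-1)) =
  (1 + n%:R^-1) * (K ^+ 2 * (n%:R * harm n)) + K ^+ 2.
  have n1 : 1 + n%:R != 0 :> R by rewrite nat1r pnatr_eq0.
  by rewrite -nat1r; field; rewrite n1 nn.
by rewrite lerD2r ler_wpM2l// addr_ge0// invr_ge0.
Qed.

End walk.

(** * Characteristic functions of additive functionals *)
Section martingale_weights.
Variable R : realType.

(* [mweight k * S_(k+1)] is the martingale attached to the walk: the conditional
   mean of the next step after [k+1] steps is [S_(k+1) / (2 (k+1))]. *)
Definition mweight k : R := \prod_(i < k) (1 + (2 * i.+1%:R)^-1)^-1.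
(** Compares [mweight k ^+ 2] with [1 / (k+1)]. It decreases to a positive limit ([pi / 4], by
    Wallis' product), which later cancels between the frequency [th] and the sum of the squared
    weights. *)
Definition mratio k : R := k.+1%:R * mweight k ^+ 2.

Let factor_gt0 k : 0 < 1 + (2 * k.+1%:R)^-1 :> R.
Proof. by rewrite addr_gt0// invr_gt0 mulr_gt0. Qed.

Lemma mweight_gt0 k : 0 < mweight k.
Proof. by apply: prodr_gt0 => i _; rewrite invr_gt0 factor_gt0. Qed.

Lemma mweightS k : mweight k.+1 * (1 + (2 * k.+1%:R)^-1) = mweight k.
Proof. by rewrite /mweight big_ord_recr /= mulfVK// gt_eqF// factor_gt0. Qed.

Lemma mweight0 : mweight 0 = 1.
Proof. by rewrite /mweight big_ord0. Qed.

Lemma mratioS k : mratio k = mratio k.+1 * (1 + (4 * k.+1%:R * k.+2%:R)^-1).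
Proof.
rewrite /mratio -mweightS.
have h1 : k.+1%:R != 0 :> R by rewrite pnatr_eq0.
have h2 : k.+2%:R != 0 :> R by rewrite pnatr_eq0.
have e : k.+2%:R = k.+1%:R + 1 :> R by rewrite natr1.
move: h1 h2 e; move: (k.+1%:R : R) (k.+2%:R : R) => x y h1 h2 e.
by rewrite e in h2 *; field; rewrite h1 h2.
Qed.

Lemma mratio_ge0 k : 0 <= mratio k.
Proof. by rewrite mulr_ge0// sqr_ge0. Qed.

Lemma mratio_nonincreasing k : mratio k.+1 <= mratio k.
Proof. by rewrite (mratioS k) ler_peMr ?mratio_ge0// lerDl invr_ge0 !mulr_ge0. Qed.

Lemma mratio_le1 k : mratio k <= 1.
Proof.
elim: k => [|k IH]; first by rewrite /mratio mweight0 expr1n mulr1.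
exact: le_trans (mratio_nonincreasing k) IH.
Qed.

(** The corrected sequence [mratio k * (1 - 1 / (4 (k+1)))] is nondecreasing and starts at [3/4];
    the correction makes the induction go through. *)
Lemma mratio_ge k : 3 / 4 <= mratio k.
Proof.
suff : 3 / 4 <= mratio k * (1 - (4 * k.+1%:R)^-1).
  have h : 0 <= (4 * k.+1%:R)^-1 :> R by rewrite invr_ge0 mulr_ge0.
  by move=> /le_trans; apply; apply: ler_piMr; [exact: mratio_ge0|rewrite gerBl].
elim: k => [|k IH].
  by rewrite /mratio mweight0 expr1n !mulr1 mul1r; lra.
apply: (le_trans IH); rewrite (mratioS k) -mulrA ler_wpM2l ?mratio_ge0//.
have h1 : 0 < k.+1%:R :> R by rewrite ltr0n.
have e : k.+2%:R = k.+1%:R + 1 :> R by rewrite natr1.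
move: h1 e; move: (k.+1%:R : R) (k.+2%:R : R) => x y h1 ->.
rewrite -subr_ge0.
have -> : 1 - (4 * (x + 1))^-1 - (1 + (4 * x * (x + 1))^-1) * (1 - (4 * x)^-1) =
  (4 * x * (x + 1))^-1 * (4 * x)^-1.
  by field; rewrite !gt_eqF// addr_gt0.
by rewrite mulr_ge0// invr_ge0 !mulr_ge0// ?addr_ge0// ltW.
Qed.

Lemma cvg_mratio : cvgn mratio.
Proof.
apply: nonincreasing_is_cvgn; last by exists 0 => _ [k _ <-]; exact: mratio_ge0.
by apply/nonincreasing_seqP => k; exact: mratio_nonincreasing.
Qed.

Lemma lim_mratio_neq0 : limn mratio != 0.
Proof.
rewrite gt_eqF// (@lt_le_trans _ _ (3 / 4))//.
by apply: limr_ge; [exact: cvg_mratio|apply: nearW => k; exact: mratio_ge].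
Qed.

Lemma cvgn_sqrt0 (u : nat -> R) : u @ \oo --> (0 : R) -> Num.sqrt (u n) @[n --> \oo] --> (0 : R).
Proof.
move=> u0; rewrite -(sqrtr0 R).
exact: (cvg_comp _ _ u0 (@sqrt_continuous R 0)).
Qed.

End martingale_weights.

(** * Limit of the characteristic function of one additive functional *)

Section walk_clt.
Variables (R : realType) (d : nat).
Hypothesis d0 : (0 < d)%N.
Let p : R := (2 * d%:R + 1) / (4 * d%:R).
Notation V := 'cV[R]_d.
Notation st := (steps R d).
Variables (f : V -> R) (K b : R).
Hypothesis f0 : \sum_(y <- st) f y = 0.
Hypothesis fK : {in st, forall y, `|f y| <= K}.
Let Q : R := (\sum_(y <- st) f y ^+ 2) / (2 * d%:R).
Let T (s : seq V) := \sum_(x <- s) f x.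
(** Fluctuation of the conditional variance. Its summand has zero sum over the steps, so
    [wexp_sum_sqr] applies to [G] exactly as to [T]. *)
Let G (s : seq V) := \sum_(x <- s) (f x ^+ 2 - Q).

Lemma sum_steps_cst (c : R) : \sum_(y <- st) c = c * (2 * d%:R).
Proof. rewrite sum_steps sumr_const card_ord -mulr_natr; ring. Qed.

Let K0 : 0 <= K.
Proof.
have i : 'I_d by exact: (Ordinal d0).
apply: le_trans (normr_ge0 _) (fK (x := ebasis R i) _).
by apply/stepsP; exists i; left.
Qed.

Let dR0 : 0 < 2 * d%:R :> R. Proof. by rewrite mulr_gt0 ?ltr0n. Qed.

Let f2K y : y \in st -> f y ^+ 2 <= K ^+ 2.
Proof. by move=> ys; rewrite -real_normK ?num_real// lerXn2r ?nnegrE ?fK. Qed.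

Let Q0 : 0 <= Q.
Proof. by rewrite divr_ge0 ?(ltW dR0)//; apply: sumr_ge0 => y _; exact: sqr_ge0. Qed.

Let QK : Q <= K ^+ 2.
Proof.
rewrite /Q ler_pdivrMr// -sum_steps_cst big_seq [leRHS]big_seq.
by apply: ler_sum => y; exact: f2K.
Qed.

Let sum_G : \sum_(y <- st) (f y ^+ 2 - Q) = 0.
Proof.
rewrite big_split /= -[X in _ + X]/(\sum_(y <- st) - Q) sum_steps_cst /Q.
by field; exact: dR_neq0.
Qed.

Let GK : {in st, forall y, `|f y ^+ 2 - Q| <= K ^+ 2}.
Proof.
move=> y ys; have h1 := f2K ys; have h2 := sqr_ge0 (f y).
by rewrite ler_norml; apply/andP; split; [have := QK|have := Q0]; lra.
Qed.

(* Second order Taylor expansion around the conditional mean: the first order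
   term vanishes and the conditional variance is [Q + G s / (2 n) - (T s / (2 n))^2]
   for a history [s] of length [n]. *)
Lemma cond_char_bound n (w : R) s : size s = n.+1 -> {subset s <= st} ->
  `|\sum_(y <- st) step_prob p s y * cos (w * (T s + f y) + b) -
    expR (- (w ^+ 2 * Q / 2)) * cos (w * (1 + (2 * n.+1%:R)^-1) * T s + b)| <=
  w ^+ 2 * (8 * K ^+ 3 * `|w| + 17 * K ^+ 4 * w ^+ 2
            + 4^-1 * (`|G s| / n.+1%:R) + 8^-1 * (T s / n.+1%:R) ^+ 2).
Proof.
move=> sz sst.
have nn : n.+1%:R != 0 :> R by rewrite pnatr_eq0.
have n0 : 0 < n.+1%:R :> R by rewrite ltr0n.
have s0 : s != [::] by rewrite -size_eq0 sz.
have szN : (size s)%:R = n.+1%:R :> R by rewrite sz.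
move: nn n0 szN; move: (n.+1%:R : R) => N nn n0 szN {sz}.
pose m := T s / (2 * N).
pose A := w * (1 + (2 * N)^-1) * T s + b.
pose P y := step_prob p s y.
have P0 y : 0 <= P y by exact: step_prob_ge0.
have P1 : \sum_(y <- st) P y = 1 by exact: sum_step_prob1.
have Pf : \sum_(y <- st) P y * f y = m.
  by rewrite sum_step_prob// f0 szN -/(T s) mul0r addr0.
have Pf2 : \sum_(y <- st) P y * f y ^+ 2 = Q + G s / (2 * N).
  rewrite sum_step_prob// szN /G big_split /= -[\sum_(i <- s) - Q]/(\sum_(i <- s) (- Q)).
  rewrite big_const_seq count_predT iter_addr_0 -[- Q *+ _]mulr_natr szN /Q.
  by field; rewrite nn (dR_neq0 R d0).
have eA y : w * (T s + f y) + b = A + w * (f y - m).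
  by rewrite /A /m; field.
pose r y := cos (A + w * (f y - m)) -
  (cos A - w * (f y - m) * sin A - (w * (f y - m)) ^+ 2 / 2 * cos A).
have S1 : \sum_(y <- st) P y * (f y - m) = 0.
  under eq_bigr do rewrite mulrBr.
  by rewrite big_split /= Pf sumrN -mulr_suml P1 mul1r subrr.
have S2 : \sum_(y <- st) P y * (f y - m) ^+ 2 = Q + G s / (2 * N) - m ^+ 2.
  transitivity (\sum_(y <- st) (P y * f y ^+ 2 - (2 * m) * (P y * f y) + P y * m ^+ 2)).
    by apply: eq_bigr => y _; ring.
  rewrite !big_split /= sumrN -mulr_sumr -mulr_suml Pf Pf2 P1; ring.
have e1 : \sum_(y <- st) P y * cos (w * (T s + f y) + b) =
    \sum_(y <- st) P y * r y +
    cos A * (1 - w ^+ 2 * (Q + G s / (2 * N) - m ^+ 2) / 2).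
  transitivity (\sum_(y <- st) (P y * r y + (P y * cos A - (w * sin A) * (P y * (f y - m))
      - (w ^+ 2 / 2 * cos A) * (P y * (f y - m) ^+ 2)))).
    by apply: eq_bigr => y _; rewrite eA /r; field.
  rewrite !big_split /= !sumrN -!mulr_sumr -mulr_suml P1 S1 S2; field.
  by rewrite nn.
have Tn : `|T s| <= N * K.
  rewrite -szN mulr_natl -iter_addr_0 -(count_predT s) -big_const_seq.
  rewrite (le_trans (ler_norm_sum _ _ _))// big_seq [leRHS]big_seq.
  by apply: ler_sum => x xs; rewrite fK ?sst.
have mK : `|m| <= K.
  rewrite normrM normfV ler_pdivrMr ?normr_gt0 ?mulf_neq0// (le_trans Tn)//.
  rewrite [`|2 * N|]ger0_norm ?mulr_ge0 ?(ltW n0)// mulrC ler_wpM2l//.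
  by rewrite ler_peMl ?(ltW n0)// ler1n.
have rB y : y \in st -> `|r y| <= (2 * K * `|w|) ^+ 3 + (2 * K * `|w|) ^+ 4.
  move=> ys; apply: (le_trans (cos_taylor _ _)).
  have h : `|w * (f y - m)| <= 2 * K * `|w|.
    rewrite normrM mulrC ler_wpM2r// (le_trans (ler_normB _ _))//.
    by have := fK ys; lra.
  have hk : 0 <= 2 * K * `|w| by rewrite !mulr_ge0.
  apply: lerD; first by rewrite lerXn2r ?nnegrE.
  rewrite -[_ ^+ 4]ger0_norm ?exprn_even_ge0// normrX.
  by rewrite lerXn2r ?nnegrE.
have Sr : `|\sum_(y <- st) P y * r y| <= (2 * K * `|w|) ^+ 3 + (2 * K * `|w|) ^+ 4.
  rewrite (le_trans (ler_norm_sum _ _ _))//.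
  apply: (@le_trans _ _ (\sum_(y <- st) P y * ((2 * K * `|w|) ^+ 3 + (2 * K * `|w|) ^+ 4))); last first.
    by rewrite -mulr_suml P1 mul1r.
  rewrite big_seq [leRHS]big_seq; apply: ler_sum => y ys.
  by rewrite normrM ger0_norm ?P0// ler_wpM2l ?P0// rB.
rewrite -/(P _) e1 -/A.
have -> : \sum_(y <- st) P y * r y +
    cos A * (1 - w ^+ 2 * (Q + G s / (2 * N) - m ^+ 2) / 2) -
    expR (- (w ^+ 2 * Q / 2)) * cos A =
  \sum_(y <- st) P y * r y + cos A * ((1 - w ^+ 2 * Q / 2 - expR (- (w ^+ 2 * Q / 2)))
    - w ^+ 2 / 2 * (G s / (2 * N) - m ^+ 2)).
  by ring.
set D := 1 - _ - _.
have DB : `|D| <= (w ^+ 2 * K ^+ 2 / 2) ^+ 2.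
  have u0 : 0 <= w ^+ 2 * Q / 2 by rewrite divr_ge0// mulr_ge0// sqr_ge0.
  apply: (le_trans (expRN_bound u0)).
  have u1 : w ^+ 2 * Q / 2 <= w ^+ 2 * K ^+ 2 / 2.
    by rewrite ler_pM2r ?invr_gt0// ler_wpM2l ?sqr_ge0.
  by apply: lerXn2r => //; rewrite nnegrE (le_trans u0).
have GB : `|w ^+ 2 / 2 * (G s / (2 * N) - m ^+ 2)| <=
    w ^+ 2 / 2 * (2^-1 * (`|G s| / N) + 4^-1 * (T s / N) ^+ 2).
  have w22 : 0 <= w ^+ 2 / 2 by rewrite divr_ge0// sqr_ge0.
  rewrite normrM (ger0_norm w22) ler_wpM2l//.
  rewrite (le_trans (ler_normB _ _))// lerD//.
    rewrite normrM normfV [`|2 * _|]ger0_norm ?mulr_ge0 ?(ltW n0)// invfM.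
    by rewrite le_eqVlt; apply/orP; left; apply/eqP; ring.
  rewrite ger0_norm ?sqr_ge0// /m le_eqVlt; apply/orP; left; apply/eqP.
  by field.
rewrite (le_trans (ler_normD _ _))//.
have cB : `|cos A * (D - w ^+ 2 / 2 * (G s / (2 * N) - m ^+ 2))| <=
   (w ^+ 2 * K ^+ 2 / 2) ^+ 2 +
   w ^+ 2 / 2 * (2^-1 * (`|G s| / N) + 4^-1 * (T s / N) ^+ 2).
  rewrite normrM (le_trans (ler_piMl _ (cos_max A)))//.
  by rewrite (le_trans (ler_normB _ _))// lerD.
apply: (le_trans (lerD Sr cB)).
have w3 : `|w| ^+ 3 = w ^+ 2 * `|w| by rewrite exprSr real_normK ?num_real.
have w4 : `|w| ^+ 4 = w ^+ 2 * w ^+ 2.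
  by rewrite -exprD -normrX ger0_norm// exprn_even_ge0.
have x0 : 0 <= w ^+ 2 * w ^+ 2 * K ^+ 4 by rewrite mulr_ge0 ?exprn_ge0// mulr_ge0 ?sqr_ge0.
have -> : (2 * K * `|w|) ^+ 3 = 8 * K ^+ 3 * (w ^+ 2 * `|w|) by rewrite -w3; ring.
have -> : (2 * K * `|w|) ^+ 4 = 16 * K ^+ 4 * (w ^+ 2 * w ^+ 2) by rewrite -w4; ring.
rewrite -subr_ge0.
(* The factor 17 is 16 from the fourth order Taylor remainder plus 1/4 from the error of the
   exponential, rounded up; the slack is 3/4. *)
set gg := `|G s| / N; set tt := (T s / N) ^+ 2.
have -> : w ^+ 2 *
 (8 * K ^+ 3 * `|w| + 17 * K ^+ 4 * w ^+ 2 + 4^-1 * gg + 8^-1 * tt) -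
 (8 * K ^+ 3 * (w ^+ 2 * `|w|) + 16 * K ^+ 4 * (w ^+ 2 * w ^+ 2) +
  ((w ^+ 2 * K ^+ 2 / 2) ^+ 2 + w ^+ 2 / 2 * (2^-1 * gg + 4^-1 * tt))) =
  3 / 4 * (w ^+ 2 * w ^+ 2 * K ^+ 4) by field.
by rewrite mulr_ge0.
Qed.

(** Up to a constant, the bound of [wexp_sum_sqr] on the root mean square of [T / n] and of
    [G / n]. *)
Let del n : R := Num.sqrt (harm R n / n%:R).
(** Chosen to dominate every coefficient of [cond_char_bound] after averaging, so that one constant
    serves all four error terms. *)
Let C : R := 8 * K ^+ 3 + 17 * K ^+ 4 + 2 * K ^+ 2 + 1.

Let del_sqr n : del n ^+ 2 = harm R n / n%:R.
Proof. by rewrite sqr_sqrtr// divr_ge0// harm_ge0. Qed.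

Let del_gt0 n : 0 < del n.+1.
Proof.
rewrite sqrtr_gt0 divr_gt0 ?ltr0n// /harm big_ord_recl /= ltr_pwDl ?invr_gt0//.
by apply: sumr_ge0 => i _; rewrite invr_ge0.
Qed.

Let C_ge0 : 0 <= C.
Proof. by rewrite !addr_ge0// !mulr_ge0// exprn_ge0. Qed.

Lemma wexp_sqr_mean_le n : wexp n.+1 (fun s => (T s / n.+1%:R) ^+ 2) <= K ^+ 2 * del n.+1 ^+ 2.
Proof.
have -> : (fun s => (T s / n.+1%:R) ^+ 2) = (fun s => (n.+1%:R ^+ 2)^-1 * T s ^+ 2).
  by apply/funext => s; rewrite exprMn exprVn mulrC.
rewrite wexpZ ler_pdivrMl ?exprn_gt0 ?ltr0n//.
apply: (le_trans (wexp_sum_sqr d0 _ f0 fK)); rewrite del_sqr.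
by rewrite le_eqVlt; apply/orP; left; apply/eqP; field.
Qed.

(** Cauchy-Schwarz in the form [|u| <= (c + u^2 / c) / 2], with [c] bounding the root mean square.
    The 1 in [K ^+ 2 + 1] keeps [c] invertible when [K = 0]. *)
Lemma wexp_abs_mean_le n :
  wexp n.+1 (fun s => `|G s| / n.+1%:R) <= (K ^+ 2 + 1) * del n.+1.
Proof.
set c := (K ^+ 2 + 1) * del n.+1.
have c0 : 0 < c by rewrite mulr_gt0 ?del_gt0// ltr_wpDl ?sqr_ge0.
have E2 : wexp n.+1 (fun s => (G s / n.+1%:R) ^+ 2) <= c ^+ 2.
  have -> : (fun s => (G s / n.+1%:R) ^+ 2) = (fun s => (n.+1%:R ^+ 2)^-1 * G s ^+ 2).
    by apply/funext => s; rewrite exprMn exprVn mulrC.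
  rewrite wexpZ ler_pdivrMl ?exprn_gt0 ?ltr0n//.
  apply: (le_trans (wexp_sum_sqr d0 _ sum_G GK)).
  have -> : n.+1%:R ^+ 2 * c ^+ 2 = (K ^+ 2 + 1) ^+ 2 * (n.+1%:R ^+ 2 * del n.+1 ^+ 2).
    by rewrite /c; ring.
  have -> : n.+1%:R ^+ 2 * del n.+1 ^+ 2 = n.+1%:R * harm R n.+1.
    by rewrite del_sqr; field.
  rewrite ler_wpM2r ?mulr_ge0 ?harm_ge0//.
  by rewrite lerXn2r ?nnegrE ?addr_ge0 ?sqr_ge0// lerDl.
apply: (@le_trans _ _ (wexp n.+1 (fun s => 2^-1 * (c + c^-1 * (G s / n.+1%:R) ^+ 2)))).
  apply: le_wexp => // s _ _.
  have -> : `|G s| / n.+1%:R = `|G s / n.+1%:R| by rewrite normrM normfV [`|n.+1%:R|]ger0_norm.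
  move: (G s / _) => u; rewrite -(real_normK (num_real u)).
  rewrite -(ler_pM2l c0) -subr_ge0.
  have -> : c * (2^-1 * (c + c^-1 * `|u| ^+ 2)) - c * `|u| = 2^-1 * (c - `|u|) ^+ 2.
    by field; rewrite gt_eqF.
  by rewrite mulr_ge0 ?invr_ge0 ?sqr_ge0.
rewrite wexpZ wexpD wexp_cst// wexpZ.
have : c^-1 * wexp n.+1 (fun s => (G s / n.+1%:R) ^+ 2) <= c.
  by rewrite ler_pdivrMl// -expr2.
lra.
Qed.

Let Phi n (w : R) : R := wexp n (fun s => cos (w * T s + b)).

Lemma char_step n (w : R) :
  `|Phi n.+2 w - expR (- (w ^+ 2 * Q / 2)) * Phi n.+1 (w * (1 + (2 * n.+1%:R)^-1))| <=
  w ^+ 2 * (C * (`|w| + w ^+ 2 + del n.+1 + del n.+1 ^+ 2)).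
Proof.
rewrite /Phi wexpS -wexpZ -wexpB.
apply: (le_trans (ler_norm_wexp d0 _ _)).
apply: (@le_trans _ _ (wexp n.+1 (fun s => w ^+ 2 * (8 * K ^+ 3 * `|w| + 17 * K ^+ 4 * w ^+ 2
            + 4^-1 * (`|G s| / n.+1%:R) + 8^-1 * (T s / n.+1%:R) ^+ 2)))).
  apply: le_wexp => // s sz sst.
  under eq_bigr do rewrite /T big_rcons -/(T s) /=.
  exact: cond_char_bound.
rewrite wexpZ ler_wpM2l ?sqr_ge0// !wexpD wexp_cst// wexp_cst// !wexpZ.
have h1 := wexp_abs_mean_le n; have h2 := wexp_sqr_mean_le n.
have k2 := sqr_ge0 K; have k3 := exprn_ge0 3 K0; have k4 := exprn_ge0 4 K0.
have w0 := normr_ge0 w; have w2 := sqr_ge0 w; have e0 := ltW (del_gt0 n); have e2 := sqr_ge0 (del n.+1).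
rewrite /C; set x := wexp _ _ in h1 *; set y := wexp _ _ in h2 *.
move: (K ^+ 2) (K ^+ 3) (K ^+ 4) (w ^+ 2) (`|w| : R) (del n.+1) k2 k3 k4 w2 w0 e2 e0 h1 h2.
move=> k2 k3 k4 w2 w1 e1 ? ? ? ? ? ? ? h1 h2.
have : 0 <= (8 * k3 + 2 * k2 + 1) * w2 by apply: mulr_ge0 => //; lra.
have : 0 <= (17 * k4 + 2 * k2 + 1) * w1 by apply: mulr_ge0 => //; lra.
have : 0 <= (8 * k3 + 17 * k4 + k2) * e1 by apply: mulr_ge0 => //; lra.
have : 0 <= (8 * k3 + 17 * k4 + k2 + 1) * e1 ^+ 2 by apply: mulr_ge0 => //; lra.
have : 0 <= k2 * e1 ^+ 2 by apply: mulr_ge0.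
have : 0 <= (k2 + 1) * e1 by apply: mulr_ge0 => //; lra.
lra.
Qed.

(** By [mweightS], the frequency shift in [char_step] carries [th * mweight (j+1)] to
    [th * mweight j], so the steps chain; the exponential factors are at most 1 and never amplify
    earlier errors. The descent stops at one step, the last time before memory exists. *)
Lemma char_telescope (th : R) j : 0 <= th ->
  `|Phi j.+1 (th * mweight R j) -
    expR (- (Q / 2 * (th ^+ 2 * \sum_(k < j) mweight R k.+1 ^+ 2))) * Phi 1 th| <=
  \sum_(k < j) (th * mweight R k.+1) ^+ 2 * (C * (th * mweight R k.+1 +
     (th * mweight R k.+1) ^+ 2 + del k.+1 + del k.+1 ^+ 2)).
Proof.
move=> th0; elim: j => [|j IH].
  by rewrite !big_ord0 !mulr0 oppr0 expR0 mul1r mweight0 mulr1 subrr normr0.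
rewrite [leRHS]big_ord_recr /=; set w := th * mweight R j.+1.
have w0 : 0 <= w by rewrite mulr_ge0// ltW// mweight_gt0.
have ew : w * (1 + (2 * j.+1%:R)^-1) = th * mweight R j by rewrite /w -mulrA mweightS.
have h := char_step j w; rewrite (ger0_norm w0) ew in h.
set S := \sum_(k < j.+1) _.
set e := expR (- (w ^+ 2 * Q / 2)) in h.
have -> : expR (- (Q / 2 * (th ^+ 2 * S))) =
    e * expR (- (Q / 2 * (th ^+ 2 * \sum_(k < j) mweight R k.+1 ^+ 2))).
  by rewrite /S big_ord_recr /= -expRD; congr expR; rewrite /w; ring.
have e1 : `|e| <= 1.
  rewrite ger0_norm ?expR_ge0// expR_le1 oppr_le0.
  by rewrite divr_ge0// mulr_ge0// sqr_ge0.
set u := Phi j.+1 _ in h IH *; set v := Phi j.+2 _ in h *.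
set x := expR _ in IH *; set y := Phi 1 th in IH *.
have -> : v - e * x * y = e * (u - x * y) + (v - e * u) by ring.
rewrite (le_trans (ler_normD _ _))// lerD// normrM (le_trans _ IH)//.
by rewrite ler_piMl.
Qed.

Theorem cvg_walk_char :
  wexp n (fun s => cos ((Num.sqrt (n%:R * ln n%:R))^-1 * T s + b)) @[n --> \oo]
  --> expR (- (Q / 2)) * cos b.
Proof.
rewrite -cvg_shiftS /=.
pose L j : R := ln j.+1%:R.
(* The starting frequency for which [th j * mweight j] is exactly the normalisation at time
   [n = j + 1]. *)
pose th j : R := (mweight R j)^-1 * (Num.sqrt (j.+1%:R * L j))^-1.
have th0 j : 0 <= th j by rewrite mulr_ge0 ?invr_ge0 ?sqrtr_ge0// ltW// mweight_gt0.
have thE j : (Num.sqrt (j.+1%:R * L j))^-1 = th j * mweight R j.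
  by rewrite /th mulrAC mulVf ?mul1r// gt_eqF// mweight_gt0.
have L0 j : 0 <= L j by rewrite ln_ge0// ler1n.
have th2 j : th j ^+ 2 = (mratio R j * L j)^-1.
  rewrite /th -invfM exprVn exprMn sqr_sqrtr ?mulr_ge0// /mratio; congr (_^-1).
  by ring.
have iL : (L j)^-1 @[j --> \oo] --> (0 : R).
  by have := @cvgn_inv_ln R; rewrite -cvg_shiftS.
have lr : mratio R @ \oo --> limn (mratio R) by exact: cvg_mratio.
have r0 := lim_mratio_neq0 R.
pose S j := th j ^+ 2 * \sum_(k < j) mweight R k.+1 ^+ 2.
have cS : S j @[j --> \oo] --> (1 : R).
  have h1 : (\sum_(k < j.+1) mratio R k / k.+1%:R) / L j @[j --> \oo] --> limn (mratio R).
    by have := log_cesaro lr; rewrite -cvg_shiftS.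
  (* The logarithmic mean of [mratio] has a term [k = 0], equal to 1, that [S] lacks since its
     weights start at [mweight 1]; removing it costs [1 / L j]. *)
  have h2 : (mratio R j)^-1 * ((\sum_(k < j.+1) mratio R k / k.+1%:R) / L j - (L j)^-1)
      @[j --> \oo] --> (limn (mratio R))^-1 * (limn (mratio R) - 0).
    by apply: cvgM; [exact: cvgV|apply: cvgB].
  rewrite subr0 mulVf// in h2.
  apply: (cvg_trans _ h2); apply: near_eq_cvg; apply: nearW => j /=.
  rewrite /S th2 [(_ * L j)^-1]invfM -[RHS]mulrA; congr (_ * _).
  rewrite big_ord_recl /= {1}/mratio mweight0 expr1n mulr1 divr1 mulrDl mul1r addrC addKr mulrC.
  congr (_ * _); apply: eq_bigr => k _; rewrite /mratio /bump /= add1n.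
  by field.
have c1 : Phi 1 (th j) @[j --> \oo] --> cos b.
  have cth : th j @[j --> \oo] --> (0 : R).
    have -> : th = (fun j => Num.sqrt ((mratio R j)^-1 * (L j)^-1)).
      by apply/funext => j; rewrite -invfM -th2 sqrtr_sqr ger0_norm.
    apply: cvgn_sqrt0; rewrite -[X in _ --> X](mulr0 (limn (mratio R))^-1).
    by apply: cvgM => //; exact: cvgV.
  have B : \forall j \near \oo, cos b - K * th j <= Phi 1 (th j) <= cos b + K * th j.
    apply: nearW => j; rewrite -ler_distl -[X in `|_ - X|](wexp_cst d0 1) -wexpB.
    rewrite (le_trans (ler_norm_wexp d0 _ _))// -[leRHS](wexp_cst d0 1).
    apply: le_wexp => // s sz sst; rewrite [_ * T s + b]addrC (le_trans (norm_cosDB_le _ _))//.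
    rewrite normrM (ger0_norm (th0 j)) mulrC ler_wpM2r//.
    case: s sz sst => [//|x [|//]] _ sst; rewrite /T big_seq1 fK// sst//.
    by rewrite mem_head.
  have c0 : K * th j @[j --> \oo] --> (0 : R).
    by rewrite -[X in _ --> X](mulr0 K); apply: cvgM => //; exact: cvg_cst.
  apply: (squeeze_cvgr B).
    rewrite -[X in _ --> X]subr0; apply: cvgB => //; exact: cvg_cst.
  rewrite -[X in _ --> X]addr0; apply: cvgD => //; exact: cvg_cst.
pose M j := expR (- (Q / 2 * S j)) * Phi 1 (th j).
have cM : M j @[j --> \oo] --> expR (- (Q / 2)) * cos b.
  apply: cvgM => //; rewrite -[in X in _ --> X](mulr1 (Q / 2)).
  apply: (cvg_comp (fun j => - (Q / 2 * S j)) expR); last exact: continuous_expR.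
  by apply: cvgN; apply: cvgM => //; exact: cvg_cst.
(* Bounds the bracket in [char_telescope] uniformly in [j], through [w^2 <= 4 / (k+1)]. The factor
   [1 / L j] is dropped here and kept only in the outer [w^2], where the logarithmic mean needs
   it. *)
pose x k : R := 2 * Num.sqrt (k.+1%:R^-1) + 4 * k.+1%:R^-1 + del k.+1 + del k.+1 ^+ 2.
have x0 k : 0 <= x k by rewrite !addr_ge0 ?mulr_ge0 ?sqrtr_ge0 ?invr_ge0 ?sqr_ge0.
have cx : x @ \oo --> (0 : R).
  have ch : k.+1%:R^-1 @[k --> \oo] --> (0 : R) by exact: cvg_harmonic.
  have cd : del k.+1 @[k --> \oo] --> (0 : R).
    apply: cvgn_sqrt0; have := @cvgn_harm_mean R; by rewrite -cvg_shiftS.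
  have -> : 0 = 2 * 0 + 4 * 0 + 0 + 0 ^+ 2 :> R by rewrite expr2; ring.
  apply: cvgD; last by rewrite expr2; apply: (cvgM cd cd).
  apply: cvgD => //; apply: cvgD; apply: cvgM => //; try exact: cvg_cst.
  exact: cvgn_sqrt0.
have err : 4 / 3 * C * ((\sum_(k < j.+1) x k / k.+1%:R) / L j) @[j --> \oo] --> (0 : R).
  rewrite -[X in _ --> X](mulr0 (4 / 3 * C)); apply: cvgM; first exact: cvg_cst.
  by have := log_cesaro cx; rewrite -cvg_shiftS.
suff H : \forall j \near \oo, M j - 4 / 3 * C * ((\sum_(k < j.+1) x k / k.+1%:R) / L j) <=
    wexp j.+1 (fun s => cos ((Num.sqrt (j.+1%:R * L j))^-1 * T s + b)) <=
    M j + 4 / 3 * C * ((\sum_(k < j.+1) x k / k.+1%:R) / L j).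
  apply: (squeeze_cvgr H).
    by rewrite -[X in _ --> X]subr0; exact: cvgB.
  by rewrite -[X in _ --> X]addr0; exact: cvgD.
have nL : \forall j \near \oo, 1 <= L j.
  by have [N _ H] := near_ln_ge (1 : R); exists N => // j /= Nj; apply: H => /=; exact: leqW.
near=> j.
have L1 : 1 <= L j by near: j.
have Lp : 0 < L j by exact: lt_le_trans L1.
rewrite -ler_distl thE -/(Phi _ _).
apply: (le_trans (char_telescope j (th0 j))).
(* The constant 4/3 is the inverse of the lower bound in [mratio_ge]. *)
have wB k : (th j * mweight R k.+1) ^+ 2 <= 4 / 3 * (k.+1%:R^-1 / L j).
  have mj := mratio_ge R j; have mk := mratio_le1 R k.+1.
  have -> : (th j * mweight R k.+1) ^+ 2 =
      (mratio R j)^-1 * ((mratio R k.+1 / k.+2%:R) / L j).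
    rewrite exprMn th2 invfM /mratio; field.
    by rewrite !gt_eqF// mweight_gt0.
  apply: ler_pM.
  - by rewrite invr_ge0 mratio_ge0.
  - by rewrite !divr_ge0// mratio_ge0.
  - by rewrite -[4 / 3]invrK lef_pV2 ?posrE ?invf_div// (lt_le_trans _ mj).
  - rewrite ler_wpM2r ?invr_ge0// -[leRHS]mul1r ler_pM ?mratio_ge0 ?invr_ge0//.
    by rewrite lef_pV2 ?posrE ?ltr0n// ler_nat.
apply: (@le_trans _ _ (4 / 3 * C * ((\sum_(k < j) x k / k.+1%:R) / L j))); last first.
  rewrite ler_wpM2l ?mulr_ge0// ler_wpM2r ?invr_ge0//.
  by rewrite [leRHS]big_ord_recr /= lerDl divr_ge0.
rewrite mulr_suml mulr_sumr; apply: ler_sum => k _.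
have k0 : 0 <= k.+1%:R^-1 :> R by rewrite invr_ge0.
have wk := wB k; set w := th j * mweight R k.+1 in wk *.
have w0 : 0 <= w by rewrite mulr_ge0// ltW// mweight_gt0.
have w4 : w ^+ 2 <= 4 * k.+1%:R^-1.
  apply: (le_trans wk).
  have h : k.+1%:R^-1 / L j <= k.+1%:R^-1 :> R by rewrite ler_piMr// invf_le1.
  by apply: ler_pM => //; [rewrite divr_ge0|lra].
have w2 : w <= 2 * Num.sqrt (k.+1%:R^-1).
  rewrite -[w]ger0_norm// -sqrtr_sqr (le_trans (ler_wsqrtr w4))//.
  by rewrite sqrtrM// (_ : 4 = 2 ^+ 2) ?sqrtr_sqr ?ger0_norm// expr2; ring.
have -> : 4 / 3 * C * (x k / k.+1%:R / L j) = 4 / 3 * (k.+1%:R^-1 / L j) * (C * x k) by ring.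
apply: ler_pM => //; first exact: sqr_ge0.
  by rewrite mulr_ge0// !addr_ge0 ?sqr_ge0// ltW.
by rewrite ler_wpM2l// /x !lerD.
Unshelve. all: by end_near. Qed.

End walk_clt.

(** * Trigonometric approximation *)
Section trig_poly.
Variables (R : realType) (d : nat).
Notation V := 'cV[R]_d.

Definition dotv (t x : V) : R := \sum_(i < d) t i 0 * x i 0.

Definition trig (l : seq (R * V * R)) (x : V) : R :=
  \sum_(a <- l) a.1.1 * cos (dotv a.1.2 x + a.2).

Definition trigq l (A : R) (B : 'I_d -> R) (x : V) : R :=
  trig l x + A + \sum_(i < d) B i * x i 0 ^+ 2.

Lemma dotvDl t1 t2 x : dotv (t1 + t2) x = dotv t1 x + dotv t2 x.
Proof. by rewrite /dotv -big_split; apply: eq_bigr => i _; rewrite mxE mulrDl. Qed.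

Lemma dotvBl t1 t2 x : dotv (t1 - t2) x = dotv t1 x - dotv t2 x.
Proof. by rewrite /dotv -sumrB; apply: eq_bigr => i _; rewrite !mxE mulrBl. Qed.

Lemma dotv0l x : dotv 0 x = 0.
Proof. by rewrite /dotv big1// => i _; rewrite mxE mul0r. Qed.

Definition is_trig (h : V -> R) := exists l, forall x, h x = trig l x.

Lemma is_trig_cos t b : is_trig (fun x => cos (dotv t x + b)).
Proof. by exists [:: (1, t, b)] => x; rewrite /trig big_seq1 mul1r. Qed.

Lemma is_trigZ c h : is_trig h -> is_trig (fun x => c * h x).
Proof.
move=> [l hl]; exists [seq (c * a.1.1, a.1.2, a.2) | a <- l] => x.
by rewrite hl /trig big_map mulr_sumr; apply: eq_bigr => a _; rewrite mulrA.
Qed.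

Lemma is_trig_cst c : is_trig (fun=> c).
Proof.
exists [:: (c, 0, 0)] => x.
by rewrite /trig big_seq1 /= dotv0l addr0 cos0 mulr1.
Qed.

Lemma is_trigD g h : is_trig g -> is_trig h -> is_trig (fun x => g x + h x).
Proof.
move=> [l gl] [l' hl]; exists (l ++ l') => x.
by rewrite /trig big_cat /= gl hl.
Qed.

Lemma is_trig_sum (I : Type) (r : seq I) (F : I -> V -> R) :
  (forall i, is_trig (F i)) -> is_trig (fun x => \sum_(i <- r) F i x).
Proof.
move=> H; elim: r => [|i r IH].
  by have [l hl] := is_trig_cst 0; exists l => x; rewrite big_nil.
have [l hl] := is_trigD (H i) IH; by exists l => x; rewrite big_cons.
Qed.

Lemma is_trigM g h : is_trig g -> is_trig h -> is_trig (fun x => g x * h x).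
Proof.
move=> [l gl] [l' hl].
have H a a' : is_trig (fun x : V => (a.1.1 * cos (dotv a.1.2 x + a.2)) *
    (a'.1.1 * cos (dotv a'.1.2 x + a'.2))).
  have [k kE] := is_trigD
    (is_trigZ (a.1.1 * a'.1.1 / 2) (is_trig_cos (a.1.2 + a'.1.2) (a.2 + a'.2)))
    (is_trigZ (a.1.1 * a'.1.1 / 2) (is_trig_cos (a.1.2 - a'.1.2) (a.2 - a'.2))).
  exists k => x; rewrite -kE dotvDl dotvBl.
  have -> : dotv a.1.2 x + dotv a'.1.2 x + (a.2 + a'.2) =
    (dotv a.1.2 x + a.2) + (dotv a'.1.2 x + a'.2) by ring.
  have -> : dotv a.1.2 x - dotv a'.1.2 x + (a.2 - a'.2) =
    (dotv a.1.2 x + a.2) - (dotv a'.1.2 x + a'.2) by ring.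
  by move: (dotv a.1.2 x + a.2) (dotv a'.1.2 x + a'.2) => u v; rewrite cosD cosB; field.
have [k kE] := is_trig_sum l (fun a => is_trig_sum l' (H a)).
exists k => x; rewrite -kE gl hl /trig mulr_suml; apply: eq_bigr => a _.
by rewrite mulr_sumr.
Qed.

Lemma is_trig_prod (I : Type) (r : seq I) (F : I -> V -> R) :
  (forall i, is_trig (F i)) -> is_trig (fun x => \prod_(i <- r) F i x).
Proof.
move=> H; elim: r => [|i r IH].
  by have [l hl] := is_trig_cst 1; exists l => x; rewrite big_nil.
have [l hl] := is_trigM (H i) IH; by exists l => x; rewrite big_cons.
Qed.

Lemma is_trigX n h : is_trig h -> is_trig (fun x => h x ^+ n).
Proof.
move=> hh; have [l hl] := is_trig_prod (index_iota 0 n) (fun=> hh).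
by exists l => x; rewrite -hl big_const_nat subn0 iter_mulr_1.
Qed.

Lemma is_trig_sin (c : R) (i : 'I_d) : is_trig (fun x => sin (c * x i 0)).
Proof.
have [l hl] := is_trig_cos (c *: delta_mx i 0) (- (pi / 2)).
exists l => x; rewrite -hl -cosBpihalf; congr (cos (_ + _)).
rewrite /dotv (bigD1 i)//= big1 ?addr0 => [|j ji]; first by rewrite !mxE !eqxx mulr1.
by rewrite !mxE (negbTE ji) mulr0 mul0r.
Qed.

End trig_poly.

(** * Bernstein polynomials and the binomial law *)

Section bernstein.
Variable R : realType.

Definition bern m (u : R) k : R := 'C(m, k)%:R * u ^+ k * (1 - u) ^+ (m - k).

Lemma bern_ge0 m u k : 0 <= u <= 1 -> 0 <= bern m u k.
Proof. by case/andP => u0 u1; rewrite /bern !mulr_ge0// exprn_ge0// subr_ge0. Qed.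

Lemma sum_bern m u : \sum_(k < m.+1) bern m u k = 1.
Proof.
rewrite -[RHS](expr1n R m) -[in RHS](subrK u 1) exprDn.
by apply: eq_bigr => k _; rewrite /bern -[RHS]mulr_natr; ring.
Qed.

(** Pascal's rule, read as conditioning a binomial variable on one of its trials. *)
Lemma sum_bernS m u (F : nat -> R) :
  \sum_(k < m.+2) bern m.+1 u k * F k =
  \sum_(k < m.+1) bern m u k * (u * F k.+1 + (1 - u) * F k).
Proof.
under [RHS]eq_bigr do rewrite mulrDr.
rewrite big_split /= big_ord_recl.
have -> : \sum_(i < m.+1) bern m u i * (u * F i.+1) =
  \sum_(i < m.+1) 'C(m, i)%:R * u ^+ i.+1 * (1 - u) ^+ (m - i) * F i.+1.
  by apply: eq_bigr => i _; rewrite /bern exprS; ring.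
have -> : \sum_(i < m.+1) bern m.+1 u (lift ord0 i) * F (lift ord0 i) =
  \sum_(i < m.+1) 'C(m, i)%:R * u ^+ i.+1 * (1 - u) ^+ (m - i) * F i.+1 +
  \sum_(i < m.+1) 'C(m, i.+1)%:R * u ^+ i.+1 * (1 - u) ^+ (m - i) * F i.+1.
  rewrite -big_split; apply: eq_bigr => i _ /=.
  by rewrite /bern /bump /= add1n binS natrD subSS; ring.
rewrite addrCA; congr (_ + _).
rewrite [RHS]big_ord_recl [X in _ + X = _]big_ord_recr /=.
rewrite bin_small// !mul0r addr0; congr (_ + _).
  by rewrite /bern !bin0 !expr0 !mulr1 !mul1r !subn0 exprS; ring.
apply: eq_bigr => i _; rewrite /bern /bump /= add1n.
by rewrite -[(m - i)%N](subnSK (ltn_ord i)) [(1 - u) ^+ _.+1]exprS; ring.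
Qed.

(** The binomial variance: averaging the centred square over one further trial adds exactly
    [u (1 - u)]. *)
Lemma bern_moment2 m u :
  \sum_(k < m.+1) bern m u k * (k%:R - m%:R * u) ^+ 2 = m%:R * (u * (1 - u)).
Proof.
have M1 n : \sum_(k < n.+1) bern n u k * (k%:R - n%:R * u) = 0.
  elim: n => [|n IH]; first by rewrite big_ord1 mul0r subrr mulr0.
  rewrite (@sum_bernS n u (fun k => k%:R - n.+1%:R * u)) -[RHS]IH; apply: eq_bigr => k _.
  by rewrite -!natr1; ring.
elim: m => [|m IH]; first by rewrite big_ord1 mul0r subrr expr0n mulr0 mul0r.
rewrite (@sum_bernS m u (fun k => (k%:R - m.+1%:R * u) ^+ 2)).
transitivity (\sum_(k < m.+1) (bern m u k * (k%:R - m%:R * u) ^+ 2 + bern m u k * (u * (1 - u)))).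
  by apply: eq_bigr => k _; rewrite -!natr1; ring.
by rewrite big_split /= IH -mulr_suml sum_bern -natr1; ring.
Qed.

End bernstein.

(** * Approximation by trigonometric polynomials with quadratic error *)

Section trig_approximation.
Variables (R : realType) (d : nat).
Notation V := 'cV[R]_d.

Lemma continuous_trmx m n : continuous (fun v : 'M[R]_(m, n) => v^T).
Proof.
move=> v A /nbhs_ballP[e /= e0 eA]; apply/nbhs_ballP; exists e => //= w [_ vw].
by apply: eA; split=> // i j; rewrite !mxE; exact: vw.
Qed.

(** Only [x] is confined to the box: [y] will be an interpolation node, which may lie outside. Hence
    compactness is applied to the property of having a uniform radius around [x], on row vectors,
    rather than to the restriction of [g]. *)
Lemma unif_cont_box (g : V -> R) (L e : R) : continuous g -> 0 < e ->
  exists2 dl : R, 0 < dl & forall x y : V, (forall i, `|x i 0| <= L) ->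
    (forall i, `|x i 0 - y i 0| < dl) -> `|g x - g y| <= e.
Proof.
move=> cg e0.
have cK := @rV_compact R d (fun=> `[- L, L]%classic) (fun=> @segment_compact R (- L) L).
pose h (v : 'rV[R]_d) := g v^T.
have ch : continuous h.
  by move=> v; apply: continuous_comp; [exact: continuous_trmx|exact: cg].
have cov : \forall dl \near (0 : R)^'+, [set v : 'rV[R]_d | forall i, `[- L, L]%classic (v ord0 i)]
    `<=` (fun v => forall y, ball v dl y -> `|h v - h y| <= e).
  move/compact_near_coveringP: cK; apply => v _.
  have e2 : 0 < e / 2 by rewrite divr_gt0.
  have /cvgrPdist_lt/(_ _ e2)/nbhs_ballP[r /= r0 vr] := ch v.
  have r2 : 0 < r / 2 by rewrite divr_gt0.
  exists (ball v (r / 2), [set x | x < r / 2]) => /=.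
    by split; [exact: nbhsx_ballx|exact: nbhs_right_lt].
  move=> [w dl] /= [vw dlr] y wy.
  have vy : ball v r y.
    rewrite (splitr r); apply: ball_triangle vw _.
    exact: le_ball (ltW dlr) _ wy.
  have vw' : ball v r w by apply: le_ball vw; rewrite ler_pdivrMr// ler_peMr ?(ltW r0)// ler1n.
  have := ltW (vr _ vy); have := ltW (vr _ vw') => h1 h2.
  rewrite -(subrK (h v) (h w)) -addrA (le_trans (ler_normD _ _))// (splitr e) lerD//.
  by rewrite distrC.
near (0 : R)^'+ => dl.
have dl0 : 0 < dl by near: dl; exact: nbhs_right_gt.
exists dl => //.
move=> x y xL xy.
have H : [set v : 'rV[R]_d | forall i, `[- L, L]%classic (v ord0 i)]
    `<=` (fun v => forall y, ball v dl y -> `|h v - h y| <= e) by near: dl.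
have := H x^T; rewrite /h trmxK /= => /(_ _ y^T); rewrite trmxK; apply.
  by move=> i; rewrite mxE /= in_itv /= -ler_norml.
by split=> // i j; rewrite !mxE ord1; exact: xy.
Unshelve. all: by end_near. Qed.

(* Bernstein's tensor operator of [g] on [-K, K]^d, evaluated at
   [K sin (x_i / K)], is a bounded trigonometric polynomial. *)
Lemma trig_approx (g : V -> R) (M e : R) : continuous g ->
  (forall x, `|g x| <= M) -> 0 < e ->
  exists l, forall x, `|g x - trig l x| <= e * (1 + \sum_(i < d) x i 0 ^+ 2).
Proof.
move=> cg gM e0.
have M0 : 0 <= M by exact: le_trans (normr_ge0 (g 0)) (gM 0).
(* Outside the box some [|x_i|] exceeds [L], and the trivial bound [2 M <= e * L ^+ 2] is already
   below the allowed error. *)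
pose L := Num.sqrt (2 * M / e) + 1.
have L0 : 0 < L by rewrite ltr_wpDl// sqrtr_ge0.
have LM : 2 * M <= e * L ^+ 2.
  rewrite [leRHS]mulrC -ler_pdivrMr//.
  have q0 : 0 <= 2 * M / e by rewrite divr_ge0 ?mulr_ge0// ltW.
  rewrite -{1}(sqr_sqrtr q0) lerXn2r ?nnegrE ?sqrtr_ge0 ?(ltW L0)//.
  by rewrite /L lerDl.
have e2 : 0 < e / 2 by rewrite divr_gt0.
have [dl dl0 gdl] := unif_cont_box L cg e2.
(* Either all coordinates are [dl]-close, or one squared difference is at least [dl ^+ 2] and this
   [c] pays for the oscillation [2 M]. *)
pose c := 2 * M / dl ^+ 2.
have c0 : 0 <= c by apply: divr_ge0; [rewrite mulr_ge0|rewrite exprn_ge0// ltW].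
have gq (x y : V) : (forall i, `|x i 0| <= L) ->
    `|g x - g y| <= e / 2 + c * \sum_(i < d) (x i 0 - y i 0) ^+ 2.
  move=> xL; have s0 : 0 <= \sum_(i < d) (x i 0 - y i 0) ^+ 2.
    by apply: sumr_ge0 => i _; exact: sqr_ge0.
  have [/forallP H|] := boolP [forall i, `|x i 0 - y i 0| < dl].
    by rewrite (le_trans (gdl x y xL H))// lerDl mulr_ge0.
  rewrite negb_forall => /existsP[i]; rewrite -leNgt => hi.
  rewrite ler_wpDl ?(ltW e2)//.
  apply: (@le_trans _ _ (2 * M)).
    by rewrite (le_trans (ler_normB _ _))// mulr_natl mulr2n lerD.
  rewrite /c mulrAC ler_pdivlMr ?exprn_gt0// ler_wpM2l ?mulr_ge0//.
  rewrite (bigD1 i)//= ler_wpDr//.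
    by apply: sumr_ge0 => j _; exact: sqr_ge0.
  by rewrite -[leRHS]real_normK ?num_real// lerXn2r ?nnegrE// ltW.
(* The amplitude [K] makes [K sin (x / K)] close to [x] on the box. *)
pose D : R := c * d%:R.
have D0 : 0 <= D by rewrite mulr_ge0.
have [K K1 KB] : exists2 K : R, 1 <= K & D * (2 * (L ^+ 3 / K ^+ 2) ^+ 2) <= e / 4.
  pose A := D * (2 * (L ^+ 3) ^+ 2).
  have A0 : 0 <= A by apply: mulr_ge0 => //; apply: mulr_ge0 => //; exact: sqr_ge0.
  have e4 : 0 < e / 4 by rewrite divr_gt0.
  pose K := 1 + A / (e / 4).
  have K1 : 1 <= K by rewrite lerDl divr_ge0// ltW.
  exists K => //.
  have Kp : 0 < K by exact: lt_le_trans K1.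
  have -> : D * (2 * (L ^+ 3 / K ^+ 2) ^+ 2) = A / K ^+ 4.
    by rewrite /A; field; rewrite gt_eqF.
  rewrite ler_pdivrMr ?exprn_gt0// mulrC -ler_pdivrMr//.
  apply: (@le_trans _ _ K); first by rewrite lerDr.
  by rewrite -[leLHS]expr1 ler_weXn2l.
have Kp : 0 < K by exact: lt_le_trans K1.
have [m m0 mB] : exists2 m, (0 < m)%N & D * (2 * K ^+ 2 / m%:R) <= e / 4.
  pose A := D * (2 * K ^+ 2) / (e / 4).
  exists (Num.bound A).+1 => //.
  have A0 : 0 <= A.
    apply: divr_ge0; last by rewrite ltW// divr_gt0.
    by apply: mulr_ge0 => //; apply: mulr_ge0 => //; exact: sqr_ge0.
  rewrite mulrA ler_pdivrMr// [leRHS]mulrC -ler_pdivrMr ?divr_gt0// -/A.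
  have := archi_boundP A0 => /ltW/le_trans; apply.
  by rewrite ler_nat.
have mR0 : m%:R != 0 :> R by rewrite pnatr_eq0 -lt0n.
pose u (t : R) := (1 + sin (K^-1 * t)) / 2.
have u01 t : 0 <= u t <= 1.
  have := sin_geN1 (K^-1 * t); have := sin_le1 (K^-1 * t) => h1 h2.
  by rewrite /u; apply/andP; split; lra.
pose z (k : nat) : R := K * (2 * (k%:R / m%:R) - 1).
pose node (F : {ffun 'I_d -> 'I_m.+1}) : V := \col_i z (F i).
(* The law of a random node with independent binomial coordinates. Sums over nodes factor over
   coordinates, so a function of one coordinate only sees its own binomial law. *)
pose W (x : V) (F : {ffun 'I_d -> 'I_m.+1}) := \prod_(i < d) bern m (u (x i 0)) (F i).
have W0 (x : V) F : 0 <= W x F by apply: prodr_ge0 => i _; exact: bern_ge0.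
have W1 (x : V) : \sum_F W x F = 1.
  rewrite -(bigA_distr_bigA (fun i (k : 'I_m.+1) => bern m (u (x i 0)) k)) /=.
  by rewrite big1// => i _; exact: sum_bern.
have W2 (x : V) i : \sum_F W x F * (x i 0 - z (F i)) ^+ 2 =
    \sum_(k < m.+1) bern m (u (x i 0)) k * (x i 0 - z k) ^+ 2.
  transitivity (\sum_(F : {ffun 'I_d -> 'I_m.+1}) \prod_(j < d) (bern m (u (x j 0)) (F j) *
      (if j == i then (x j 0 - z (F j)) ^+ 2 else 1))).
    apply: eq_bigr => F _; rewrite big_split /=; congr (_ * _).
    rewrite (bigD1 i)//= eqxx big1 ?mulr1// => j ji.
    by rewrite (negbTE ji).
  rewrite -(bigA_distr_bigA (fun j (k : 'I_m.+1) => bern m (u (x j 0)) k *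
      (if j == i then (x j 0 - z k) ^+ 2 else 1))) /=.
  rewrite (bigD1 i)//= eqxx [X in _ * X]big1 ?mulr1// => j ji.
  rewrite (negbTE ji); under eq_bigr do rewrite mulr1.
  exact: sum_bern.
(* Bias and variance: [t - y] is the Taylor error of sine, while [z k - y = (2 K / m) (k - m u)]
   brings in the binomial variance, with [u (1 - u) <= 1/4]. *)
have W3 (t : R) : `|t| <= L ->
    \sum_(k < m.+1) bern m (u t) k * (t - z k) ^+ 2 <=
    2 * K ^+ 2 / m%:R + 2 * (L ^+ 3 / K ^+ 2) ^+ 2.
  move=> tL; pose y := K * sin (K^-1 * t).
  have yt : (t - y) ^+ 2 <= (L ^+ 3 / K ^+ 2) ^+ 2.
    rewrite -[leLHS]real_normK ?num_real// lerXn2r ?nnegrE ?divr_ge0 ?exprn_ge0 ?(ltW Kp) ?(ltW L0)//.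
    have -> : t - y = - (K * (sin (K^-1 * t) - K^-1 * t)) by rewrite /y; field; rewrite gt_eqF.
    rewrite normrN normrM (gtr0_norm Kp).
    apply: (le_trans (ler_wpM2l (ltW Kp) (norm_sinB_le _))).
    rewrite normrM normfV (gtr0_norm Kp).
    have -> : K * (K^-1 * `|t|) ^+ 3 = `|t| ^+ 3 / K ^+ 2 by field; rewrite gt_eqF.
    by rewrite ler_wpM2r ?invr_ge0 ?exprn_ge0 ?(ltW Kp)// lerXn2r ?nnegrE ?(ltW L0).
  apply: (@le_trans _ _ (\sum_(k < m.+1) (8 * K ^+ 2 / m%:R ^+ 2 *
     (bern m (u t) k * (k%:R - m%:R * u t) ^+ 2) + bern m (u t) k * (2 * (t - y) ^+ 2)))).
    apply: ler_sum => k _.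
    have -> : 8 * K ^+ 2 / m%:R ^+ 2 * (bern m (u t) k * (k%:R - m%:R * u t) ^+ 2) +
        bern m (u t) k * (2 * (t - y) ^+ 2) =
      bern m (u t) k * (2 * (z k - y) ^+ 2 + 2 * (t - y) ^+ 2).
      by rewrite /z /y /u; field.
    rewrite ler_wpM2l ?bern_ge0//.
    by have := sqr_ge0 (t - y + (z k - y)); nra.
  rewrite big_split /= -mulr_sumr bern_moment2 -mulr_suml sum_bern mul1r lerD//; last first.
    by rewrite ler_pM2l.
  have -> : 8 * K ^+ 2 / m%:R ^+ 2 * (m%:R * (u t * (1 - u t))) =
    2 * K ^+ 2 / m%:R * (4 * (u t * (1 - u t))) by field.
  rewrite ler_piMr//; first by apply: divr_ge0 => //; apply: mulr_ge0 => //; exact: sqr_ge0.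
  by have := sqr_ge0 (2 * u t - 1); nra.
have [l lE] : is_trig (fun x => \sum_F W x F * g (node F)).
  apply: is_trig_sum => F; under eq_fun do rewrite mulrC.
  apply: is_trigZ; apply: is_trig_prod => i.
  have tu : is_trig (fun x : V => u (x i 0)).
    have [l lE] := is_trigZ 2^-1 (is_trigD (is_trig_cst d 1) (is_trig_sin K^-1 i)).
    by exists l => x; rewrite -lE /u mulrC.
  have tu1 : is_trig (fun x : V => 1 - u (x i 0)).
    have [l lE] := is_trigD (is_trig_cst d 1) (is_trigZ (-1) tu).
    by exists l => x; rewrite -lE mulN1r.
  apply: is_trigM; last exact: is_trigX.
  by apply: is_trigZ; exact: is_trigX.
exists l => x; rewrite -lE.
have -> : g x - \sum_F W x F * g (node F) = \sum_F W x F * (g x - g (node F)).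
  by under [RHS]eq_bigr do rewrite mulrBr; rewrite sumrB -mulr_suml W1 mul1r.
have x20 : 0 <= \sum_(i < d) x i 0 ^+ 2 by apply: sumr_ge0 => i _; exact: sqr_ge0.
apply: (le_trans (ler_norm_sum _ _ _)).
under eq_bigr do rewrite normrM (ger0_norm (W0 _ _)).
have [/forallP xL|] := boolP [forall i, `|x i 0| <= L].
  apply: (@le_trans _ _ (\sum_F (W x F * (e / 2) +
      c * \sum_(i < d) W x F * (x i 0 - z (F i)) ^+ 2))).
    apply: ler_sum => F _; rewrite -mulr_sumr [c * _]mulrCA -[leRHS]mulrDr ler_wpM2l//.
    rewrite (le_trans (gq x (node F) xL))// lerD2l ler_wpM2l//.
    by apply: ler_sum => i _; rewrite mxE.
  rewrite big_split /= -mulr_suml W1 mul1r -mulr_sumr exchange_big /=.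
  apply: (@le_trans _ _ (e / 2 + c * \sum_(i < d) (2 * K ^+ 2 / m%:R + 2 * (L ^+ 3 / K ^+ 2) ^+ 2))).
    rewrite lerD2l ler_wpM2l//; apply: ler_sum => i _.
    by rewrite W2; exact: W3.
  rewrite sumr_const card_ord -[_ *+ d]mulr_natl [c * _]mulrA -/D [D * _]mulrDr.
  have : 0 <= e * \sum_(i < d) x i 0 ^+ 2 by rewrite mulr_ge0// ltW.
  rewrite [e * (1 + _)]mulrDr mulr1; move: mB KB.
  move: (D * _) (D * _) => p1 p2; set S := e * \sum_(i < d) _.
  by lra.
rewrite negb_forall => /existsP[i]; rewrite -ltNge => hi.
apply: (@le_trans _ _ (2 * M)).
  apply: (@le_trans _ _ (\sum_F W x F * (2 * M))); last by rewrite -mulr_suml W1 mul1r.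
  apply: ler_sum => F _.
  rewrite ler_wpM2l// (le_trans (ler_normB _ _))//.
  by rewrite mulr_natl mulr2n lerD.
apply: (le_trans LM); rewrite ler_wpM2l ?(ltW e0)//.
rewrite ler_wpDl// (bigD1 i)//= ler_wpDr//.
  by apply: sumr_ge0 => j _; exact: sqr_ge0.
by rewrite -[leRHS]real_normK ?num_real// lerXn2r ?nnegrE ?(ltW L0) ?(ltW hi).
Qed.

End trig_approximation.

(** * Gaussian integrals *)
Section normal_density.
Variables (R : realType) (s : R).
Hypothesis s0 : s != 0.
Notation mu := (@lebesgue_measure R).
Notation N := (normal_prob 0 s).

(** Change of variables holds for the Radon-Nikodym derivative, which agrees almost everywhere with
    [normal_pdf] because both have the same integral over every measurable set. *)
Lemma ge0_integral_normal_prob (f : R -> \bar R) :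
  measurable_fun setT f -> (forall x, 0 <= f x)%E ->
  (\int[N]_x f x = \int[mu]_x (f x * (normal_pdf 0 s x)%:E))%E.
Proof.
move=> mf f0.
have dom := @normal_prob_dominates R 0 s.
rewrite -(Radon_Nikodym_SigmaFinite.change_of_variables dom)//.
apply: ae_eq_integral => //.
- apply: emeasurable_funM => //.
  exact: (measurable_int _ (Radon_Nikodym_SigmaFinite.f_integrable dom)).
- apply: emeasurable_funM => //.
  by apply/measurable_EFinP; exact: measurable_normal_pdf.
apply: ae_eqe_mul2l.

apply: integral_ae_eq => //.
- exact: Radon_Nikodym_SigmaFinite.f_integrable.
- by apply/measurable_EFinP; exact: measurable_normal_pdf.
- by move=> A _ mA; rewrite -Radon_Nikodym_SigmaFinite.f_integral.
Qed.

Lemma integrable_mul_normal_pdf (f : R -> R) :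
  N.-integrable setT (EFin \o f) ->
  mu.-integrable setT (fun x => (f x * normal_pdf 0 s x)%:E).
Proof.
move=> /integrableP[mf fi]; apply/integrableP; split.
  apply/measurable_EFinP/measurable_funM; first exact/measurable_EFinP.
  exact: measurable_normal_pdf.
rewrite (_ : (\int[mu]_x _)%E = (\int[N]_x `|(EFin \o f) x|)%E)//.
rewrite ge0_integral_normal_prob//; last exact: measurableT_comp.
apply: eq_integral => x _; rewrite /= -EFinM normrM.
by rewrite (ger0_norm (normal_pdf_ge0 _ _ _)).
Qed.

Lemma integral_normal_prob (f : R -> R) :
  N.-integrable setT (EFin \o f) ->
  (\int[N]_x (f x)%:E = \int[mu]_x (f x * normal_pdf 0 s x)%:E)%E.
Proof.
move=> fi; have mf := measurable_int _ fi.
rewrite integralE [RHS]integralE; congr (_ - _)%E.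
- rewrite ge0_integral_normal_prob//; last exact: measurable_funepos.
  apply: eq_integral => x _; rewrite !funeposE /= -!EFin_max -EFinM.
  by rewrite maxr_pMl ?normal_pdf_ge0// mul0r.
- rewrite ge0_integral_normal_prob//; last exact: measurable_funeneg.
  apply: eq_integral => x _; rewrite !funenegE /= -!EFin_max -EFinM.
  by rewrite maxr_pMl ?normal_pdf_ge0// mul0r mulNr.
Qed.

Lemma integrable_normal_le (f : R -> R) c :
  measurable_fun setT f -> (forall x, `|f x| <= c) ->
  N.-integrable setT (EFin \o f).
Proof.
move=> mf fc; apply: measurable_bounded_integrable => //.
  by rewrite /= /normal_prob integral_normal_pdf ltry.
exists c; split; first exact: num_real.
by move=> y cy x _; exact: le_trans (fc x) (ltW cy).
Qed.

(** Completing the square: an exponential times the centred density is a multiple of a shifted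
    density, which gives exponential moments without computing an integral. *)
Lemma normal_pdf_shift h x :
  normal_pdf h s x = expR (x * h / s ^+ 2) * expR (- h ^+ 2 / (s ^+ 2 *+ 2)) * normal_pdf 0 s x.
Proof.
rewrite !normal_pdfE// /normal_fun mulrCA -!expRD; congr (_ * expR _).
by field.
Qed.

Lemma integrable_expR_normal h :
  N.-integrable setT (EFin \o (fun x : R => expR (h * x))).
Proof.
have me : measurable_fun setT (fun x : R => expR (h * x)).
  by apply: measurableT_comp => //; apply: measurable_funM.
apply/integrableP; split; first exact/measurable_EFinP.
rewrite ge0_integral_normal_prob//; last exact/measurable_EFinP/measurableT_comp.
have := integrableZl measurableT (expR ((h * s ^+ 2) ^+ 2 / (s ^+ 2 *+ 2)))
  (@integrable_normal_pdf R (h * s ^+ 2) s).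
move=> /integrableP[_]; apply: le_lt_trans.
apply: ge0_le_integral => //.
- by move=> x _; rewrite mule_ge0// lee_fin normal_pdf_ge0.
- apply: emeasurable_funM; first exact/measurable_EFinP/measurableT_comp.
  by apply/measurable_EFinP; exact: measurable_normal_pdf.
- apply: measurableT_comp => //; apply: emeasurable_funM => //.
  by apply/measurable_EFinP; exact: measurable_normal_pdf.
move=> x _; rewrite /= lee_fin ger0_norm ?expR_ge0//.
rewrite (normal_pdf_shift (h * s ^+ 2)); apply: le_trans (ler_norm _).
rewrite !mulrA ler_wpM2r ?normal_pdf_ge0// -!expRD ler_expR le_eqVlt; apply/orP; left; apply/eqP.
by field.
Qed.

(** Domination by exponential moments, from [x^2 <= 2 exp |x|]. *)
Lemma integrable_sqr_normal :
  N.-integrable setT (EFin \o (fun x : R => x ^+ 2)).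
Proof.
have gi : N.-integrable setT
    (EFin \o (fun x : R => 2 * (expR (1 * x) + expR ((-1) * x)))).
  rewrite (_ : EFin \o _ = (fun x => 2%:E * ((expR (1 * x))%:E + (expR ((-1) * x))%:E))%E)//.
  apply: integrableZl => //.
  by apply: integrableD => //; exact: integrable_expR_normal.
apply: (le_integrable _ _ _ gi) => //.
  exact/measurable_EFinP/measurable_funX.
move=> x _; rewrite /= lee_fin (ger0_norm (sqr_ge0 _)).
apply: le_trans (ler_norm _).
have key (y : R) : 0 <= y -> y ^+ 2 <= 2 * expR y.
  move=> y0; have := @expR_ge1Dxn R y 1 y0; rewrite (_ : 2`! = 2)%N//; lra.
have [x0|/ltW x0] := leP 0 x.
  by rewrite mul1r (le_trans (key _ x0))// ler_pM2l// lerDl expR_ge0.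
rewrite -sqrrN (le_trans (key _ _)) ?oppr_ge0//.
by rewrite ler_pM2l// mulN1r lerDr expR_ge0.
Qed.

End normal_density.

(* No measurability is required: the iterated integrals in [gauss_expect] are
   not known to be measurable for an arbitrary [g]. *)
Lemma le_integral_fun d (T : measurableType d) (R : realType)
    (m : {measure set T -> \bar R}) (f g : T -> \bar R) :
  (forall x, f x <= g x)%E -> (\int[m]_x f x <= \int[m]_x g x)%E.
Proof.
move=> fg; rewrite /integral; apply: leeB.
- apply: ereal_sup_le => _ [h /= hf <-]; exists h => // x.
  apply: (le_trans (hf x)); rewrite !funeposE !patchE in_setT.
  by rewrite ge_max !le_max fg lexx orbT.
- apply: ereal_sup_le => _ [h /= hf <-]; exists h => // x.
  apply: (le_trans (hf x)); rewrite !funenegE !patchE in_setT.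
  by rewrite ge_max !le_max leeN2 fg lexx orbT.
Qed.

(** * Stein's identity and the Gaussian characteristic function *)

Section normal_char.
Variables (R : realType) (s : R).
Hypothesis s0 : s != 0.
Notation mu := (@lebesgue_measure R).
Notation N := (normal_prob 0 s).

Lemma measurable_cos_affine (t b : R) : measurable_fun setT (fun x : R => cos (t * x + b)).
Proof.
apply: continuous_measurable_fun => x; apply: continuous_comp; last exact: continuous_cos.
by apply: cvgD; [apply: cvgM; [exact: cvg_cst|exact: cvg_id]|exact: cvg_cst].
Qed.

Lemma integrable_cos_affine (t b : R) :
  N.-integrable setT (EFin \o (fun x : R => cos (t * x + b))).
Proof.
by apply: (@integrable_normal_le _ _ _ 1) => [|x]; [exact: measurable_cos_affine|exact: cos_max].
Qed.

Lemma sin_as_cos (t b x : R) : sin (t * x + b) = cos (t * x + (b - pi / 2)).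
Proof. by rewrite addrA cosBpihalf. Qed.

Lemma integrable_1Dsqr_normal : N.-integrable setT (EFin \o (fun x : R => 1 + x ^+ 2)).
Proof.
rewrite (_ : EFin \o _ = (fun x : R => 1%:E + (x ^+ 2)%:E)%E)//.
apply: integrableD => //; last exact: integrable_sqr_normal.
by apply: (@integrable_normal_le _ _ (cst 1) 1) => // x; rewrite /= normr1.
Qed.

Lemma integrable_xsin (t b : R) :
  N.-integrable setT (EFin \o (fun x : R => x * sin (t * x + b))).
Proof.
apply: le_integrable integrable_1Dsqr_normal => //.
  apply/measurable_EFinP/measurable_funM => //.
  by under eq_fun do rewrite sin_as_cos; exact: measurable_cos_affine.
move=> x _; rewrite /= lee_fin normrM [leRHS]ger0_norm; last by rewrite addr_ge0// sqr_ge0.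
apply: (@le_trans _ _ `|x|); first by rewrite ler_piMr// sin_max.
have := sqr_ge0 (`|x| - 1); rewrite sqrrB1 real_normK ?num_real// -mulr_natr.
by have := normr_ge0 x; lra.
Qed.

Lemma is_derive_affine (t b x : R) : is_derive x 1 (fun x : R => t * x + b) t.
Proof. by apply: is_derive_eq; rewrite /GRing.scale /=; ring. Qed.

Lemma is_derive_sin_affine (t b x : R) :
  is_derive x 1 (fun x : R => sin (t * x + b)) (t * cos (t * x + b)).
Proof.
have := @is_derive1_comp _ sin (fun x : R => t * x + b) _ _ _
  (is_derive_sin (t * x + b)) (is_derive_affine t b x).
by rewrite mulrC.
Qed.

Lemma is_derive_normal_pdf (x : R) :
  is_derive x 1 (normal_pdf 0 s) (- (x / s ^+ 2) * normal_pdf 0 s x).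
Proof.
rewrite normal_pdfE//.
have d1 : is_derive x 1 (fun x : R => (- (2 * s ^+ 2)^-1) * x ^+ 2) (- (x / s ^+ 2)).
  apply: is_derive_eq; rewrite /GRing.scale /=; by field.
have d2 := @is_derive1_comp _ expR (fun x : R => (- (2 * s ^+ 2)^-1) * x ^+ 2) _ _ _
  (is_derive_expR ((- (2 * s ^+ 2)^-1) * x ^+ 2)) d1.
have d3 := is_deriveZ (normal_peak s) d2.
rewrite (_ : (fun x0 => _) = normal_peak s \*: (expR \o (fun x : R => (- (2 * s ^+ 2)^-1) * x ^+ 2))); last first.
  apply/funext => y; rewrite /= /normal_fun; congr (_ * expR _); by field.
apply: (is_derive_eq d3).
rewrite /GRing.scale /normal_fun /=.
have -> : - (x - 0) ^+ 2 / (s ^+ 2 *+ 2) = - (2 * s ^+ 2)^-1 * x ^+ 2 by field.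
ring.
Qed.

(** The integrand is the derivative of [sin (t * x + b)] times the density. *)
Lemma integral_stein_itv (t b : R) (n : nat) : (0 < n)%N ->
  (\int[mu]_(x in `[(- n%:R)%R, n%:R])
      ((t * cos (t * x + b) - x / s ^+ 2 * sin (t * x + b)) * normal_pdf 0 s x)%:E =
   (sin (t * n%:R + b) * normal_pdf 0 s n%:R
    - sin (t * (- n%:R) + b) * normal_pdf 0 s (- n%:R))%:E)%E.
Proof.
move=> n0; pose G (x : R) := sin (t * x + b) * normal_pdf 0 s x.
have dG (x : R) : is_derive x 1 G
    ((t * cos (t * x + b) - x / s ^+ 2 * sin (t * x + b)) * normal_pdf 0 s x).
  have := is_deriveM (is_derive_sin_affine t b x) (is_derive_normal_pdf x).
  move/is_derive_eq; apply; rewrite /GRing.scale /=; ring.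
have cc (a c x : R) : {for x, continuous (fun x : R => cos (a * x + c))}.
  apply: continuous_comp; last exact: continuous_cos.
  by apply: cvgD; [apply: cvgM; [exact: cvg_cst|exact: cvg_id]|exact: cvg_cst].
rewrite EFinB -/(G _) -/(G (- n%:R)); apply: continuous_FTC2.
- by rewrite -subr_gt0 opprK -natrD ltr0n addn_gt0 n0.
- apply: continuous_subspaceT => x; apply: cvgM; last exact: continuous_normal_pdf.
  apply: cvgB; first by apply: cvgM; [exact: cvg_cst|exact: cc].
  apply: cvgM; first by apply: cvgM; [exact: cvg_id|exact: cvg_cst].
  by under eq_fun do rewrite sin_as_cos; rewrite sin_as_cos; exact: cc.
- have cG x : {for x, continuous G}.
    by apply: differentiable_continuous; apply/derivable1_diffP.
  split=> //.
  + by apply: cvg_at_right_filter; exact: cG.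
  + by apply: cvg_at_left_filter; exact: cG.
- by move=> x _; rewrite derive1E; exact: derive_val.
Qed.

Lemma cvg_normal_pdf : normal_pdf 0 s n%:R @[n --> \oo] --> 0.
Proof.
pose c := normal_peak s * (2 * s ^+ 2).
have c0 : 0 <= c.
  by rewrite /c; apply: mulr_ge0; [exact: normal_peak_ge0|rewrite mulr_ge0 ?sqr_ge0].
have H : \forall n \near \oo, 0 <= normal_pdf 0 s n%:R <= c * n%:R^-1.
  near=> n.
  have n0 : 1 <= n%:R :> R by rewrite ler1n; near: n; exact: nbhs_infty_gt.
  have n0' : 0 < n%:R :> R by rewrite (lt_le_trans _ n0).
  rewrite normal_pdf_ge0 /= normal_pdfE// /c -mulrA ler_wpM2l ?normal_peak_ge0//.
  rewrite /normal_fun subr0 mulNr expRN.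
  have s2 : 0 < 2 * s ^+ 2 by rewrite mulr_gt0// exprn_even_gt0.
  rewrite -[leRHS]invrK lef_pV2 ?posrE ?expR_gt0 ?invr_gt0 ?divr_gt0//.
  apply: le_trans (expR_ge1Dx _); rewrite invfM invrK.
  have -> : n%:R ^+ 2 / (s ^+ 2 *+ 2) = (2 * s ^+ 2)^-1 * n%:R ^+ 2 by field.
  apply: (@le_trans _ _ ((2 * s ^+ 2)^-1 * n%:R ^+ 2)); last by rewrite lerDr.
  by rewrite ler_wpM2l ?invr_ge0 ?(ltW s2)// expr2 ler_peMr// ltW.
apply: (squeeze_cvgr H); first exact: cvg_cst.
rewrite -[X in _ --> X](mulr0 c); apply: cvgM; first exact: cvg_cst.
rewrite -cvg_shiftS; exact: cvg_harmonic.
Unshelve. all: by end_near. Qed.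

(** Integration by parts on [[-n, n]]: the boundary terms vanish with the density, and dominated
    convergence passes to the whole line. *)
Lemma normal_stein (t b : R) :
  (\int[N]_x (x * sin (t * x + b)))%R = s ^+ 2 * t * (\int[N]_x cos (t * x + b))%R.
Proof.
pose g (x : R) := t * cos (t * x + b) - x / s ^+ 2 * sin (t * x + b).
have gi : N.-integrable setT (EFin \o g).
  rewrite (_ : EFin \o g = (fun x : R => t%:E * (cos (t * x + b))%:E -
     (s ^+ 2)^-1%:E * (x * sin (t * x + b))%:E)%E); last first.
    apply/funext => x; rewrite /g /= -!EFinM -EFinB; congr (_%:E); ring.
  apply: integrableB => //; apply: integrableZl => //.
    exact: integrable_cos_affine.
  exact: integrable_xsin.
have g0 : (\int[N]_x g x)%R = 0.
  have gmu := integrable_mul_normal_pdf gi.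
  rewrite /Rintegral (integral_normal_prob gi).
  pose f_ (n : nat) (x : R) : \bar R :=
    ((fun x => (g x * normal_pdf 0 s x)%:E) \_ `[(- n%:R)%R, n%:R]%classic) x.
  have mg := measurable_int _ gmu.
  have mf_ n : measurable_fun setT (f_ n).
    apply/(measurable_restrictT _ _).1 => //.
    exact: measurable_funTS.
  have f_f : {ae mu, forall x, setT x -> f_ ^~ x @ \oo --> (g x * normal_pdf 0 s x)%:E}.
    apply: aeW => x _; apply: cvg_near_cst; near=> n.
    rewrite /f_ patchE mem_set//= in_itv /= -ler_norml.
    by near: n; exact: nbhs_infty_ger.
  have f_g : {ae mu, forall x n, setT x ->
      (`|f_ n x| <= (abse \o (fun x => (g x * normal_pdf 0 s x)%:E)) x)%E}.
    by apply: aeW => x n _; rewrite /f_ patchE /=; case: ifPn => //; rewrite abse0.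
  have [_ _ H] := @dominated_convergence _ _ _ mu setT measurableT f_ _ _
    mf_ mg f_f (integrable_abse gmu) f_g.
  have H0 : (\int[mu]_x f_ n x)%E @[n --> \oo] --> 0%:E.
    have e n : (0 < n)%N -> (\int[mu]_x f_ n x)%E = (sin (t * n%:R + b) * normal_pdf 0 s n%:R
       - sin (t * (- n%:R) + b) * normal_pdf 0 s (- n%:R))%:E.
      by move=> n0; rewrite -integral_stein_itv// [RHS]integral_mkcond.
    apply: (@cvg_trans _ ((fun n : nat => (sin (t * n%:R + b) * normal_pdf 0 s n%:R
       - sin (t * (- n%:R) + b) * normal_pdf 0 s (- n%:R))%:E) @ \oo)).
      apply: near_eq_cvg; near=> n; rewrite e//; near: n; exact: nbhs_infty_gt.
    apply: cvg_EFin; first exact: nearW.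
    have B : \forall n \near \oo, - (2 * normal_pdf 0 s n%:R) <=
       sin (t * n%:R + b) * normal_pdf 0 s n%:R
       - sin (t * (- n%:R) + b) * normal_pdf 0 s (- n%:R) <= 2 * normal_pdf 0 s n%:R.
      apply: nearW => n.
      have -> : normal_pdf 0 s (- n%:R) = normal_pdf 0 s n%:R.
        by rewrite !normal_pdfE// /normal_fun !subr0 sqrrN.
      rewrite -ler_norml (le_trans (ler_normB _ _))// !normrM.
      rewrite (ger0_norm (normal_pdf_ge0 _ _ _)) -mulrDl ler_wpM2r ?normal_pdf_ge0//.
      by rewrite (_ : 2 = 1 + 1)// lerD// sin_max.
    have c2 : 2 * normal_pdf 0 s n%:R @[n --> \oo] --> 0.
      rewrite -[X in _ --> X](mulr0 2); apply: cvgM; first exact: cvg_cst.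
      exact: cvg_normal_pdf.
    apply: (squeeze_cvgr B) => //.
    by rewrite -[X in _ --> X]oppr0; exact: cvgN.
  by rewrite (cvg_unique (@ereal_hausdorff R) H H0).
have Eg : (\int[N]_x g x)%R = t * (\int[N]_x cos (t * x + b))%R -
    (s ^+ 2)^-1 * (\int[N]_x (x * sin (t * x + b)))%R.
  rewrite -!RintegralZl//; [|exact: integrable_xsin|exact: integrable_cos_affine].
  rewrite -RintegralB//.
  - by apply: eq_Rintegral => x _; rewrite /g; ring.
  - rewrite (_ : EFin \o _ = (fun x : R => t%:E * (cos (t * x + b))%:E)%E)//.
    apply: integrableZl => //; exact: integrable_cos_affine.
  - rewrite (_ : EFin \o _ = (fun x : R => (s ^+ 2)^-1%:E * (x * sin (t * x + b))%:E)%E)//.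
    apply: integrableZl => //; exact: integrable_xsin.
move: g0; rewrite Eg => /eqP; rewrite subr_eq0 => /eqP h.
have -> : s ^+ 2 * t * (\int[N]_x cos (t * x + b))%R = s ^+ 2 * (t * (\int[N]_x cos (t * x + b))%R).
  by rewrite mulrA.
by rewrite h mulrA divff ?mul1r// expf_neq0.
Unshelve. all: by end_near. Qed.

Lemma normal_char (t b : R) :
  (\int[N]_x cos (t * x + b))%R = expR (- (s ^+ 2 * t ^+ 2 / 2)) * cos b.
Proof.
pose C (t : R) := (\int[N]_x cos (t * x + b))%R.
have dc (a x : R) : is_derive a 1 (fun a : R => cos (a * x + b)) (- (x * sin (a * x + b))).
  have d1 : is_derive a 1 (fun a : R => a * x + b) x.
    by apply: is_derive_eq; rewrite /GRing.scale /=; ring.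
  have := @is_derive1_comp _ cos (fun a : R => a * x + b) _ _ _
    (is_derive_cos (a * x + b)) d1.
  by move/is_derive_eq; apply; ring.
have p1 (a x : R) : partial1of2 (fun t x : R => cos (t * x + b)) a x = - (x * sin (a * x + b)).
  by rewrite partial1of2E; exact: derive_val.
have dC (a : R) : is_derive a 1 C (- (s ^+ 2 * a * C a)).
  have aI : `]a - 1, a + 1[%classic a by rewrite /= in_itv /= ltrDl ltrBlDr ltrDl ltr01.
  have i1 (x : R) : `]a - 1, a + 1[%classic x -> N.-integrable setT (EFin \o (fun y => cos (x * y + b))).
    by move=> _; exact: integrable_cos_affine.
  have i2 (x y : R) : `]a - 1, a + 1[%classic x -> setT y -> derivable (fun t : R => cos (t * y + b)) x 1.
    by move=> _ _; exact: (@ex_derive _ _ _ _ _ _ _ (dc x y)).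
  have G0 (y : R) : 0 <= 1 + y ^+ 2 by rewrite addr_ge0// sqr_ge0.
  have Gub (x y : R) : `]a - 1, a + 1[%classic x -> setT y ->
      `|partial1of2 (fun t x : R => cos (t * x + b)) x y| <= 1 + y ^+ 2.
    move=> _ _; rewrite p1 normrN normrM.
    apply: (@le_trans _ _ `|y|); first by rewrite ler_piMr// sin_max.
    have := sqr_ge0 (`|y| - 1); rewrite sqrrB1 real_normK ?num_real// -mulr_natr.
    by have := normr_ge0 y; lra.
  have dv := derivable_under_integral measurableT aI i1 i2 G0 integrable_1Dsqr_normal Gub.
  have ev := differentiation_under_integral measurableT aI i1 i2 G0 integrable_1Dsqr_normal Gub.
  apply: DeriveDef; first exact: dv.
  rewrite -derive1E ev /C -normal_stein -mulN1r -RintegralZl//; last exact: integrable_xsin.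
  by apply: eq_Rintegral => x _; rewrite p1 mulN1r.
(* The integrating factor of [C' = - s^2 t C]: the product [C * E] is constant. *)
pose E (t : R) := expR (2^-1 * s ^+ 2 * t ^+ 2).
have dE (a : R) : is_derive a 1 E (s ^+ 2 * a * E a).
  have d1 : is_derive a 1 (fun a : R => 2^-1 * s ^+ 2 * a ^+ 2) (s ^+ 2 * a).
    by apply: is_derive_eq; rewrite /GRing.scale /=; field.
  have := @is_derive1_comp _ expR (fun a : R => 2^-1 * s ^+ 2 * a ^+ 2) _ _ _
    (is_derive_expR _) d1.
  by move/is_derive_eq; apply; rewrite mulrC.
have dCE (a : R) : is_derive a 1 (C * E) 0.
  have := is_deriveM (dC a) (dE a).
  by move/is_derive_eq; apply; rewrite /GRing.scale /=; ring.
have := is_derive_0_is_cst t 0 dCE.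
rewrite !fctE /E expr0n mulr0 expR0 mulr1.
have -> : C 0 = cos b.
  rewrite /C; under eq_Rintegral do rewrite mul0r add0r.
  rewrite /Rintegral integral_cst//= /normal_prob integral_normal_pdf mule1//.
move=> <-; rewrite mulrCA -expRD (_ : _ + _ = 0) ?expR0 ?mulr1//.
by field.
Qed.

End normal_char.

(** * Iterated Gaussian integrals by enclosure *)

Section gauss_trig.
Variables (R : realType) (d : nat) (s : R).
Hypothesis s0 : s != 0.
Notation V := 'cV[R]_d.
Notation N := (normal_prob 0 s).

Let kappa : R := (\int[N]_x (x ^+ 2))%R.

Lemma integral_trig1 (l : seq (R * R * R)) (al be : R) :
  let h x := \sum_(a <- l) a.1.1 * cos (a.1.2 * x + a.2) + al + be * x ^+ 2 in
  N.-integrable setT (EFin \o h) /\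
  (\int[N]_x h x)%R =
    \sum_(a <- l) a.1.1 * (expR (- (s ^+ 2 * a.1.2 ^+ 2 / 2)) * cos a.2) + al + be * kappa.
Proof.
have icst : N.-integrable setT (EFin \o (fun _ : R => al)).
  by apply: (@integrable_normal_le _ _ _ `|al|).
have isq : N.-integrable setT (EFin \o (fun x : R => be * x ^+ 2)).
  rewrite (_ : EFin \o _ = (fun x : R => be%:E * (x ^+ 2)%:E)%E)//.
  by apply: integrableZl => //; exact: integrable_sqr_normal.
have addI (f g : R -> R) : N.-integrable setT (EFin \o f) ->
    N.-integrable setT (EFin \o g) -> N.-integrable setT (EFin \o (fun x => f x + g x)).
  move=> fi gi; rewrite (_ : EFin \o _ = ((EFin \o f) \+ (EFin \o g))%E)//.
  exact: integrableD.
elim: l => [|a l [IHi IHe]] /=.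
  split.
    under eq_fun do rewrite big_nil add0r.
    exact: (addI (fun=> al) (fun x => be * x ^+ 2)).
  under eq_Rintegral do rewrite big_nil add0r.
  rewrite RintegralD// big_nil add0r RintegralZl//; last exact: integrable_sqr_normal.
  by rewrite Rintegral_cst//= /normal_prob integral_normal_pdf /= mulr1.
have ia : N.-integrable setT (EFin \o (fun x : R => a.1.1 * cos (a.1.2 * x + a.2))).
  rewrite (_ : EFin \o _ = (fun x : R => a.1.1%:E * (cos (a.1.2 * x + a.2))%:E)%E)//.
  by apply: integrableZl => //; exact: integrable_cos_affine.
split.
  under eq_fun do rewrite big_cons -!addrA.
  apply: (addI _ _ ia); by under eq_fun do rewrite addrA.
under eq_Rintegral do rewrite big_cons -!addrA.
rewrite RintegralD//=; last by under eq_fun do rewrite addrA.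
rewrite big_cons -!addrA; congr (_ + _).
  by rewrite RintegralZl ?normal_char//; exact: integrable_cos_affine.
under eq_Rintegral do rewrite addrA.
by rewrite IHe addrA.
Qed.

Let upd (v : V) (k : nat) (x : R) : V := \col_i (if val i == k then x else v i 0).

(* The function [trigq l A B] with its first [k] coordinates integrated out. *)
Definition gauss_trig k (l : seq (R * V * R)) A (B : 'I_d -> R) (v : V) : R :=
  \sum_(a <- l) a.1.1 * (expR (- (s ^+ 2 * (\sum_(i < d | (i < k)%N) a.1.2 i 0 ^+ 2) / 2))
      * cos (\sum_(i < d | (k <= i)%N) a.1.2 i 0 * v i 0 + a.2)) +
  (A + kappa * \sum_(i < d | (i < k)%N) B i) +
  \sum_(i < d | (k <= i)%N) B i * v i 0 ^+ 2.

Lemma gauss_trig_upd k l A B (v : V) : (k < d)%N ->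
  N.-integrable setT (EFin \o (fun x : R => gauss_trig k l A B (upd v k x))) /\
  (\int[N]_x gauss_trig k l A B (upd v k x))%R = gauss_trig k.+1 l A B v.
Proof.
move=> kd; pose o := Ordinal kd.
have lt_split (F : 'I_d -> R) :
    \sum_(i < d | (i < k.+1)%N) F i = F o + \sum_(i < d | (i < k)%N) F i.
  rewrite (bigD1 o)//=; congr (_ + _); apply: eq_bigl => i.
  by rewrite -(inj_eq val_inj) /=; lia.
have ge_split (F : 'I_d -> R) :
    \sum_(i < d | (k <= i)%N) F i = F o + \sum_(i < d | (k.+1 <= i)%N) F i.
  rewrite (bigD1 o)//=; congr (_ + _); apply: eq_bigl => i.
  by rewrite -(inj_eq val_inj) /=; lia.
have updo x : upd v k x o 0 = x by rewrite mxE eqxx.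
have updn x (i : 'I_d) : (k < i)%N -> upd v k x i 0 = v i 0.
  by move=> ki; rewrite mxE gtn_eqF.
pose l1 : seq (R * R * R) := [seq
  (a.1.1 * expR (- (s ^+ 2 * (\sum_(i < d | (i < k)%N) a.1.2 i 0 ^+ 2) / 2)), a.1.2 o 0,
   \sum_(i < d | (k.+1 <= i)%N) a.1.2 i 0 * v i 0 + a.2) | a : R * V * R <- l].
pose al := A + kappa * \sum_(i < d | (i < k)%N) B i + \sum_(i < d | (k.+1 <= i)%N) B i * v i 0 ^+ 2.
have -> : (fun x : R => gauss_trig k l A B (upd v k x)) =
    (fun x => \sum_(a <- l1) a.1.1 * cos (a.1.2 * x + a.2) + al + B o * x ^+ 2).
  apply/funext => x; rewrite /gauss_trig ge_split updo /al.
  have -> : \sum_(i < d | (k < i)%N) B i * upd v k x i 0 ^+ 2 =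
            \sum_(i < d | (k < i)%N) B i * v i 0 ^+ 2.
    by apply: eq_bigr => i ki; rewrite updn.
  rewrite [\sum_(a <- l1) _](_ : _ = \sum_(a <- l) a.1.1 *
    (expR (- (s ^+ 2 * (\sum_(i < d | (i < k)%N) a.1.2 i 0 ^+ 2) / 2))
      * cos (\sum_(i < d | (k <= i)%N) a.1.2 i 0 * upd v k x i 0 + a.2))).
    by ring.
  rewrite /l1 big_map /=; apply: eq_bigr => a _; rewrite -mulrA ge_split updo -!addrA.
  congr (_ * (_ * cos (_ + (_ + _)))).
  by apply: eq_bigr => i ki; rewrite updn.
have [/= I E] := integral_trig1 l1 al (B o); split=> //.
rewrite E /gauss_trig /l1 big_map /= /al lt_split mulrDr.
have -> : \sum_(j <- l) j.1.1 * expR (- (s ^+ 2 * (\sum_(i < d | (i < k)%N) j.1.2 i 0 ^+ 2) / 2)) *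
   (expR (- (s ^+ 2 * j.1.2 o 0 ^+ 2 / 2)) *
    cos (\sum_(i < d | (k < i)%N) j.1.2 i 0 * v i 0 + j.2)) =
 \sum_(a <- l) a.1.1 * (expR (- (s ^+ 2 * (\sum_(i < d | (i < k.+1)%N) a.1.2 i 0 ^+ 2) / 2))
      * cos (\sum_(i < d | (k.+1 <= i)%N) a.1.2 i 0 * v i 0 + a.2)).
  apply: eq_bigr => a _; rewrite lt_split mulrDr mulrDl opprD expRD.
  by rewrite -!mulrA; congr (_ * _); rewrite mulrCA.
ring.
Qed.

(** Each stage of [gauss_iter] is compared with integrals known in closed form; the induction
    carries the enclosure for every [v], because the next stage integrates over updates of [v]. *)
Lemma gauss_iter_sandwich l1 A1 B1 l2 A2 B2 (g : V -> R) k (v : V) : (k <= d)%N ->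
  (forall x, trigq l1 A1 B1 x <= g x <= trigq l2 A2 B2 x) ->
  gauss_trig k l1 A1 B1 v <= gauss_iter s k g v <= gauss_trig k l2 A2 B2 v.
Proof.
move=> + gB; elim: k v => [|k IH] v kd.
  suff E l A B : gauss_trig 0 l A B v = trigq l A B v by rewrite !E.
  have Z (F : 'I_d -> R) : \sum_(i < d | (i < 0)%N) F i = 0 by rewrite big_pred0.
  rewrite /gauss_trig /trigq /trig /dotv Z mulr0 addr0.
  congr (_ + _ + _); apply: eq_bigr => a _.
  by rewrite Z mulr0 mul0r oppr0 expR0 mul1r.
have [i1 <-] := gauss_trig_upd l1 A1 B1 v kd.
have [i2 <-] := gauss_trig_upd l2 A2 B2 v kd.
have f1 := integrable_fin_num measurableT i1.
have f2 := integrable_fin_num measurableT i2.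
rewrite /= /Rintegral.
set I := (\int[N]_x (gauss_iter s k g _)%:E)%E.
have I1 : (\int[N]_x (gauss_trig k l1 A1 B1 (upd v k x))%:E <= I)%E.
  by apply: le_integral_fun => x; rewrite lee_fin; have /andP[] := IH (upd v k x) (ltnW kd).
have I2 : (I <= \int[N]_x (gauss_trig k l2 A2 B2 (upd v k x))%:E)%E.
  by apply: le_integral_fun => x; rewrite lee_fin; have /andP[] := IH (upd v k x) (ltnW kd).
(* [fine] sends both infinities to 0, so it preserves the inequalities only once [I] is known to be
   finite. *)
have If : I \is a fin_num.
  rewrite fin_numE gt_eqF ?lt_eqF//.
    by rewrite (le_lt_trans I2)// ltey_eq f2.
  by rewrite (lt_le_trans _ I1)// ltNye_eq f1.
by apply/andP; split; apply: fine_le.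
Qed.

Lemma gauss_expect_approx (g : V -> R) l e :
  (forall x, `|g x - trig l x| <= e * (1 + \sum_(i < d) x i 0 ^+ 2)) ->
  `|gauss_expect s g - \sum_(a <- l) a.1.1 *
      (expR (- (s ^+ 2 * (\sum_(i < d) a.1.2 i 0 ^+ 2) / 2)) * cos a.2)| <=
  e * (1 + kappa * d%:R).
Proof.
move=> gl.
have H : forall x, trigq l (- e) (fun=> - e) x <= g x <= trigq l e (fun=> e) x.
  move=> x; have := gl x; rewrite ler_distl => /andP[h1 h2].
  by rewrite /trigq -!mulr_sumr; apply/andP; split; lra.
have := @gauss_iter_sandwich l (- e) (fun=> - e) l e (fun=> e) g d 0 (leqnn d) H.
rewrite /gauss_trig -/(gauss_expect s g).
have E0 (F : 'I_d -> R) : \sum_(i < d | (d <= i)%N) F i = 0.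
  by rewrite big_pred0// => i; rewrite leqNgt ltn_ord.
have E1 (F : 'I_d -> R) : \sum_(i < d | (i < d)%N) F i = \sum_(i < d) F i.
  by apply: eq_bigl => i; rewrite ltn_ord.
have E2 (c : R) : \sum_(i < d) c = c * d%:R by rewrite sumr_const card_ord mulr_natr.
rewrite !E0 !E1 !addr0 !E2.
under eq_bigr do rewrite E1 E0 add0r.
set S := \sum_(a <- l) _; rewrite ler_distl => /andP[h1 h2].
by apply/andP; split; lra.
Qed.

End gauss_trig.

Lemma cvgn_sum_seq (R : realType) (I : Type) (r : seq I) (F : I -> nat -> R) (G : I -> R) :
  (forall i, F i n @[n --> \oo] --> G i) ->
  \sum_(i <- r) F i n @[n --> \oo] --> \sum_(i <- r) G i.
Proof.
move=> FG; elim: r => [|i r IH].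
  by under eq_fun do rewrite big_nil; rewrite big_nil; exact: cvg_cst.
by under eq_fun do rewrite big_cons; rewrite big_cons; exact: cvgD.
Qed.

(** * Convergence in law *)
Section linear_forms.
Variables (R : realType) (d : nat).
Notation V := 'cV[R]_d.
Notation st := (steps R d).

Lemma dotvNr (t x : V) : dotv t (- x) = - dotv t x.
Proof. by rewrite /dotv -sumrN; apply: eq_bigr => i _; rewrite mxE mulrN. Qed.

Lemma dotvZr (c : R) (t x : V) : dotv t (c *: x) = c * dotv t x.
Proof. by rewrite /dotv mulr_sumr; apply: eq_bigr => i _; rewrite mxE mulrCA. Qed.

Lemma dotv_sumr (t : V) (w : seq V) : dotv t (\sum_(x <- w) x) = \sum_(x <- w) dotv t x.
Proof.
rewrite /dotv exchange_big /=; apply: eq_bigr => i _.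
by rewrite summxE mulr_sumr.
Qed.

Lemma dotv_ebasis (t : V) (i : 'I_d) : dotv t (ebasis R i) = t i 0.
Proof.
rewrite /dotv (bigD1 i)//= big1 ?addr0 => [|j ji]; rewrite ebasisE.
  by rewrite eqxx mulr1.
by rewrite (negbTE ji) mulr0.
Qed.

Lemma sum_dotv (t : V) : \sum_(y <- st) dotv t y = 0.
Proof. by rewrite sum_steps big1// => i _; rewrite dotvNr subrr. Qed.

Lemma sum_dotv_sqr (t : V) :
  \sum_(y <- st) dotv t y ^+ 2 = 2 * \sum_(i < d) t i 0 ^+ 2.
Proof.
rewrite sum_steps mulr_sumr; apply: eq_bigr => i _.
by rewrite dotvNr sqrrN dotv_ebasis mulr_natl mulr2n.
Qed.

Lemma dotv_steps_le (t : V) : {in st, forall y, `|dotv t y| <= \sum_(i < d) `|t i 0|}.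
Proof.
move=> y /stepsP[i yi]; have -> : `|dotv t y| = `|t i 0|.
  by case: yi => ->; rewrite ?dotvNr ?normrN dotv_ebasis.
by rewrite (bigD1 i)//= lerDl sumr_ge0.
Qed.

Lemma sum_coord (i : 'I_d) : \sum_(y <- st) y i 0 = 0.
Proof. by rewrite sum_steps big1// => j _; rewrite [in X in _ + X]mxE subrr. Qed.

Lemma norm_coord_le1 (i : 'I_d) : {in st, forall y : V, `|y i 0| <= 1}.
Proof.
have H j : `|ebasis R j i 0| <= 1.
  by rewrite ebasisE; case: (i == j); rewrite ?normr1 ?normr0.
by move=> y /stepsP[j [->|->]]; rewrite ?[(- ebasis R j) _ _]mxE ?normrN.
Qed.

End linear_forms.

Theorem theorem3p6 (R : realType) (d : nat) (hd : (1 <= d)%N) :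
  let p : R := (2 * d%:R + 1) / (4 * d%:R) in
  @conv_law_gauss R d
    (fun n g => @merw_expect R d p
                  (fun S => g ((Num.sqrt (n%:R * ln n%:R))^-1 *: S)) n)
    (Num.sqrt (d%:R^-1)).
Proof.
move=> p g cg [M gM].
have d0 : (0 < d)%N by [].
have dR : 0 < d%:R :> R by rewrite ltr0n.
set s := Num.sqrt (d%:R^-1).
have s2 : s ^+ 2 = d%:R^-1 by rewrite sqr_sqrtr// invr_ge0 ltW.
have s0 : s != 0 by rewrite gt_eqF// sqrtr_gt0 invr_gt0.
pose kappa : R := (\int[normal_prob 0 s]_x (x ^+ 2))%R.
have kappa0 : 0 <= kappa by apply: Rintegral_ge0 => x _; exact: sqr_ge0.
pose a n : R := (Num.sqrt (n%:R * ln n%:R))^-1.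
have mE (h : 'cV[R]_d -> R) n :
    merw_expect p (fun S => h (a n *: S)) n = wexp n (fun w => h (a n *: \sum_(x <- w) x)).
  by [].
(* Collects the two averages of [1 + |x|^2]: at most [1 + 2 d] for the rescaled walk, and
   [1 + kappa d] for the Gaussian law. *)
pose B := 1 + 2 * d%:R + (1 + kappa * d%:R).
have B0 : 0 < B by rewrite /B addr_gt0// ltr_pwDl// mulr_ge0// ltW.
apply/cvgrPdist_le => e e0.
pose dl := e / 2 / B.
have dl0 : 0 < dl by rewrite !divr_gt0.
have [l gl] := trig_approx cg gM dl0.
pose GL : R := \sum_(t <- l) t.1.1 *
      (expR (- (s ^+ 2 * (\sum_(i < d) t.1.2 i 0 ^+ 2) / 2)) * cos t.2).
have Gg := gauss_expect_approx s0 gl.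
rewrite -/kappa -/GL in Gg.
have cl : wexp n (fun w => trig l (a n *: \sum_(x <- w) x)) @[n --> \oo] --> GL.
  under eq_fun do rewrite /trig wexp_sum.
  apply: cvgn_sum_seq => t.
  under eq_fun do rewrite wexpZ.
  apply: cvgM; first exact: cvg_cst.
  have := @cvg_walk_char R d d0 _ _ t.2 (sum_dotv t.1.2) (@dotv_steps_le R d t.1.2).
  rewrite sum_dotv_sqr.
  (* Here [Q = |t|^2 / d], since the [2 d] steps contribute [2 |t|^2]; with [s ^+ 2 = 1/d] this is
     the Gaussian exponent. *)
  have -> : 2 * (\sum_(i < d) t.1.2 i 0 ^+ 2) / (2 * d%:R) / 2 =
    s ^+ 2 * (\sum_(i < d) t.1.2 i 0 ^+ 2) / 2.
    by rewrite s2; field; rewrite gt_eqF.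
  move=> H; apply: (cvg_trans _ H); apply: near_eq_cvg; apply: nearW => n /=.
  congr (wexp n _); apply/funext => w; congr (cos (_ + _)).
  by rewrite dotvZr dotv_sumr.
have /cvgrPdist_le/(_ _ (divr_gt0 e0 (ltr0n R 2)))[N1 _ HN1] := cl.
near=> n.
have n1 : (0 < n)%N by near: n; exact: nbhs_infty_gt.
have L1 : 1 <= ln n%:R :> R by near: n; exact: near_ln_ge.
have nN : (N1 <= n)%N by near: n; exact: nbhs_infty_ge.
have Lp : 0 < ln n%:R :> R by exact: lt_le_trans L1.
have np : 0 < n%:R :> R by rewrite ltr0n.
have h1 := HN1 n nN.
have Eg : `|wexp n (fun w => g (a n *: \sum_(x <- w) x)) -
    wexp n (fun w => trig l (a n *: \sum_(x <- w) x))| <= dl * (1 + 2 * d%:R).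
  rewrite -wexpB (le_trans (ler_norm_wexp d0 _ _))//.
  apply: (@le_trans _ _ (wexp n (fun w : seq 'cV[R]_d => dl * (1 + \sum_(i < d)
     (n%:R * ln n%:R)^-1 * (\sum_(x <- w) x i 0) ^+ 2)))).
    apply: le_wexp => // w _ _; apply: (le_trans (gl _)).
    rewrite ler_pM2l// lerD2l; apply: ler_sum => i _.
    rewrite mxE summxE exprMn /a exprVn sqr_sqrtr//.
    by rewrite mulr_ge0// ltW.
  rewrite wexpZ wexpD wexp_cst// wexp_sum ler_pM2l// lerD2l.
  have -> : 2 * d%:R = \sum_(i < d) (2 : R) by rewrite sumr_const card_ord mulr_natr.
  apply: ler_sum => i _; rewrite wexpZ.

  have := wexp_sum_sqr d0 n (sum_coord R i) (@norm_coord_le1 R d i); rewrite expr1n mul1r => h.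
  rewrite ler_pdivrMl ?mulr_gt0//; apply: (le_trans h); rewrite -mulrA ler_pM2l//.
  (* Once [1 <= ln n], [harm n <= 1 + ln n <= 2 ln n], so each rescaled coordinate has second moment
     at most 2. *)
  have h2 := harm_le_ln R n.-1; rewrite prednK// in h2.
  by apply: (le_trans h2); lra.
rewrite mE distrC.
set X := wexp n _ in Eg *; set Y := wexp n _ in Eg h1.
rewrite (_ : X - _ = (X - Y) - (GL - Y) + (GL - gauss_expect s g)); last by ring.
rewrite (le_trans (ler_normD _ _))// (le_trans (lerD (ler_normB _ _) (lexx _)))//.
rewrite [`|GL - gauss_expect _ _|]distrC.
apply: (le_trans (lerD (lerD Eg h1) Gg)).
have : dl * (1 + 2 * d%:R) + dl * (1 + kappa * d%:R) = e / 2.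
  by rewrite -mulrDr -/B /dl; field; rewrite gt_eqF.
by lra.
Unshelve. all: by end_near. Qed.
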